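(* The $2$-functor $\mathbf{SLCC}\to\mathbf{LCC}$ from strict labelled cospan categories to labelled cospan categories, given on objects by sending $\pi\colon C\to C(\ast)$ to the composite $\tilde\pi\colon C\xrightarrow{\pi}C(\ast)\to\mathbf{Csp}$ with the canonical inclusion, on $1$-morphisms by $f\mapsto(f,\mathrm{id}_{\tilde\pi})$, and on $2$-morphisms by $\gamma\mapsto\gamma$, is a biequivalence.
   Context: **Cospans.** $\mathbf{Csp}$ is the category whose objects are finite sets and whose morphisms $A\to B$ are isomorphism classes of cospans $A\to M\leftarrow B$ of finite sets (isomorphisms on $M$ compatible with the legs), composed by pushout; it is symmetric monoidal under disjoint union. Put $\underline n=\{1,\dots,n\}$. $C(\ast)$ is the permutative (symmetric strict monoidal) category with objects $\underline n$ ($n\ge0$), morphisms $\underline m\to\underline n$ the isomorphism classes of cospans $\underline m\to\underline k\leftarrow\underline n$, composition by pushout, tensor given by ordinal sum $\underline m\otimes\underline n=\underline{m+n}$, and symmetry given by flip bijections. The canonical inclusion $C(\ast)\to\mathbf{Csp}$ is a symmetric monoidal functor which is injective on objects and an equivalence. **Labelled cospan categories.** Let $\pi\colon C\to\mathbf{Csp}$ be a symmetric monoidal functor (with invertible structure maps). An object $c$ is connected if $\pi(c)$ has exactly one element. A morphism $f\colon c\to d$ with $\pi(f)=[\pi c\to M\leftarrow\pi d]$ is connected if $M$ has exactly one element, and reduced if the cospan is jointly surjective; write $\hom^{\mathrm c}$ and $\hom^{\mathrm r}$ for the sets of such morphisms. $\pi$ is a labelled cospan category if: (1) if $\pi(c)$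 has cardinality $n$, there are connected objects $c_1,\dots,c_n$ with $c\cong c_1\otimes\dots\otimes c_n$; (2) for the tensor unit $\mathbf 1$, the abelian monoid $\hom(\mathbf 1,\mathbf 1)$ is freely generated by $\hom^{\mathrm c}(\mathbf 1,\mathbf 1)$; (3) for all $c,d$, $\otimes\colon\hom^{\mathrm r}(c,d)\times\hom(\mathbf 1,\mathbf 1)\to\hom(c,d)$ is a bijection; (4) for all $c,d,c',d'$ the square with top $\otimes\colon\hom^{\mathrm r}(c,d)\times\hom^{\mathrm r}(c',d')\to\hom^{\mathrm r}(c\otimes c',d\otimes d')$, bottom $\otimes\colon\hom^{\mathrm r}_{\mathbf{Csp}}(\pi c,\pi d)\times\hom^{\mathrm r}_{\mathbf{Csp}}(\pi c',\pi d')\to\hom^{\mathrm r}_{\mathbf{Csp}}(\pi c\otimes\pi c',\pi d\otimes\pi d')$ and vertical maps induced by $\pi$ is a pullback. In the $2$-category $\mathbf{LCC}$, a $1$-morphism from $\pi\colon C\to\mathbf{Csp}$ to $\pi'\colon C'\to\mathbf{Csp}$ is a pair $(f,\alpha)$ of a symmetric monoidal functor $f\colon C\to C'$ and a monoidal natural isomorphism $\alpha\colon\pi'f\cong\pi$; a $2$-morphism $(f,\alpha)\Rightarrow(g,\beta)$ is a monoidal natural transformation $\gamma\colon f\Rightarrow g$ such that $\beta\circ(\pi'\gamma)\colon\pi'f\Rightarrow\pi$ is an isomorphism (it then equals $\alpha$). **Strict labelled cospan categories.** A strict map of permutative categories is a strict monoidal functor preserving the symmetries. A strict labelled cospan category is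 a strict map of permutative categories $\pi\colon C\to C(\ast)$ satisfying (1)–(4) (with $\mathbf{Csp}$ replaced by $C(\ast)$) and (1') if $\pi(c)=\underline n$, there are unique connected objects $c_1,\dots,c_n$ with $c=c_1\otimes\dots\otimes c_n$. In the $2$-category $\mathbf{SLCC}$, $1$-morphisms from $\pi\colon C\to C(\ast)$ to $\pi'\colon C'\to C(\ast)$ are strict maps of permutative categories $f\colon C\to C'$ with $\pi'f=\pi$; $2$-morphisms $f\Rightarrow g$ are monoidal natural transformations $\gamma$ whose whiskering $\pi'\gamma$ is the identity of $\pi$. A biequivalence is a $2$-functor that is surjective on objects up to equivalence and induces equivalences of hom-categories. *)

(* Defs.v *)
From mathcomp Require Import all_boot.
From mathcomp Require Import boolp.
From Stdlib Require List.
Set Implicit Arguments.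
Unset Strict Implicit.
Unset Printing Implicit Defensive.

Declare Scope cat_scope.
Delimit Scope cat_scope with cat.
Open Scope cat_scope.

Reserved Notation "g ∘ f" (at level 40, left associativity).
Reserved Notation "a ⊗ b" (at level 38, left associativity).
Reserved Notation "f ⊠ g" (at level 38, left associativity).

Record category := Category {
  Ob :> Type;
  Hom : Ob -> Ob -> Type;
  idm : forall a, Hom a a;
  cmp : forall a b c, Hom b c -> Hom a b -> Hom a c;
  cmpA : forall a b c d (h : Hom c d) (g : Hom b c) (f : Hom a b),
    cmp h (cmp g f) = cmp (cmp h g) f;
  cmp1m : forall a b (f : Hom a b), cmp (idm b) f = f;
  cmpm1 : forall a b (f : Hom a b), cmp f (idm a) = f
}.
Arguments Hom {C} a b : rename.
Arguments idm {C} a : rename.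
Arguments cmp {C a b c} g f : rename.
Notation "g ∘ f" := (cmp g f) : cat_scope.

(* Equality of morphisms whose endpoints need not be syntactically the same:
   [hom_eq f f'] says that [f] and [f'] have equal sources, equal targets, and
   are equal. *)
Inductive hom_eq (C : category) (a b : C) (f : Hom a b) :
    forall a' b' : C, Hom a' b' -> Prop :=
  hom_eq_refl : hom_eq f f.

Definition is_identity (C : category) (a b : C) (f : Hom a b) : Prop :=
  hom_eq (idm a) f.

Definition is_iso (C : category) (a b : C) (f : Hom a b) : Prop :=
  exists g : Hom b a, g ∘ f = idm a /\ f ∘ g = idm b.

Record iso (C : category) (a b : C) := Iso {
  fwd :> Hom a b;
  bwd : Hom b a;
  fwdK : bwd ∘ fwd = idm a;
  bwdK : fwd ∘ bwd = idm b
}.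

Record functor (C D : category) := Functor {
  fob :> C -> D;
  fmap : forall a b, Hom a b -> Hom (fob a) (fob b);
  fmap1 : forall a, fmap (idm a) = idm (fob a);
  fmapM : forall a b c (g : Hom b c) (f : Hom a b),
    fmap (g ∘ f) = fmap g ∘ fmap f
}.
Arguments fmap {C D} F {a b} f : rename.

Record nat_trans (C D : category) (F G : functor C D) := NatTrans {
  tr :> forall a, Hom (F a) (G a);
  tr_nat : forall a b (f : Hom a b), tr b ∘ fmap F f = fmap G f ∘ tr a
}.

Definition functor_id (C : category) : functor C C :=
  @Functor C C (fun a => a) (fun _ _ f => f)
    (fun a => erefl) (fun _ _ _ _ _ => erefl).

Program Definition functor_comp (C D E : category)
    (G : functor D E) (F : functor C D) : functor C E :=
  @Functor C E (fun a => G (F a)) (fun _ _ f => fmap G (fmap F f)) _ _.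
Next Obligation. by rewrite !fmap1. Qed.
Next Obligation. by rewrite !fmapM. Qed.

Definition is_equivalence (C D : category) (F : functor C D) : Prop :=
  exists G : functor D C,
    (exists eta : nat_trans (functor_id C) (functor_comp G F),
       forall a, is_iso (eta a)) /\
    (exists eps : nat_trans (functor_comp F G) (functor_id D),
       forall b, is_iso (eps b)).

(* Strict 2-categories: categories enriched in categories. The laws of the
   composition functors are equalities on 1-morphisms and [hom_eq] on
   2-morphisms. *)
Record two_category := TwoCategory {
  Ob2 :> Type;
  Hom2 : Ob2 -> Ob2 -> category;
  id1 : forall x, Hom2 x x;
  cmp1 : forall x y z, Hom2 y z -> Hom2 x y -> Hom2 x z;
  cmp2 : forall x y z (g g' : Hom2 y z) (f f' : Hom2 x y),
    Hom g g' -> Hom f f' -> Hom (cmp1 g f) (cmp1 g' f');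
  cmp2_id : forall x y z (g : Hom2 y z) (f : Hom2 x y),
    cmp2 (idm g) (idm f) = idm (cmp1 g f);
  cmp2_cmp : forall x y z (g g' g'' : Hom2 y z) (f f' f'' : Hom2 x y)
    (d' : Hom g' g'') (d : Hom g g') (c' : Hom f' f'') (c : Hom f f'),
    cmp2 (d' ∘ d) (c' ∘ c) = cmp2 d' c' ∘ cmp2 d c;
  cmp1A : forall x y z w (h : Hom2 z w) (g : Hom2 y z) (f : Hom2 x y),
    cmp1 h (cmp1 g f) = cmp1 (cmp1 h g) f;
  cmp1_1m : forall x y (f : Hom2 x y), cmp1 (id1 y) f = f;
  cmp1_m1 : forall x y (f : Hom2 x y), cmp1 f (id1 x) = f;
  cmp2A : forall x y z w (h h' : Hom2 z w) (g g' : Hom2 y z) (f f' : Hom2 x y)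
    (e : Hom h h') (d : Hom g g') (c : Hom f f'),
    hom_eq (cmp2 e (cmp2 d c)) (cmp2 (cmp2 e d) c);
  cmp2_1m : forall x y (f f' : Hom2 x y) (c : Hom f f'),
    hom_eq (cmp2 (idm (id1 y)) c) c;
  cmp2_m1 : forall x y (f f' : Hom2 x y) (c : Hom f f'),
    hom_eq (cmp2 c (idm (id1 x))) c
}.
Arguments Hom2 {T} x y : rename.
Arguments id1 {T} x : rename.
Arguments cmp1 {T x y z} g f : rename.
Arguments cmp2 {T x y z g g' f f'} d c : rename.

Record two_functor (S T : two_category) := TwoFunctor {
  fob2 :> S -> T;
  fhom : forall x y, functor (Hom2 x y) (Hom2 (fob2 x) (fob2 y));
  fhom_id : forall x, fhom x x (id1 x) = id1 (fob2 x);
  fhom_cmp1 : forall x y z (g : Hom2 y z) (f : Hom2 x y),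
    fhom x z (cmp1 g f) = cmp1 (fhom y z g) (fhom x y f);
  fhom_cmp2 : forall x y z (g g' : Hom2 y z) (f f' : Hom2 x y)
    (d : Hom g g') (c : Hom f f'),
    hom_eq (fmap (fhom x z) (cmp2 d c))
           (cmp2 (fmap (fhom y z) d) (fmap (fhom x y) c))
}.

Definition equivalent_objects (T : two_category) (x y : T) : Prop :=
  exists (f : Hom2 x y) (g : Hom2 y x),
    inhabited (iso (cmp1 g f) (id1 x)) /\ inhabited (iso (cmp1 f g) (id1 y)).

Definition is_biequivalence (S T : two_category) (F : two_functor S T) : Prop :=
  (forall y : T, exists x : S, equivalent_objects (F x) y) /\
  (forall x y : S, is_equivalence (fhom F x y)).

Record smcat := SMCat {
  smcar :> category;
  munit : smcar;
  tens : smcar -> smcar -> smcar;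
  tensm : forall a a' b b' : smcar,
    Hom a a' -> Hom b b' -> Hom (tens a b) (tens a' b');
  tensm1 : forall a b, tensm (idm a) (idm b) = idm (tens a b);
  tensmM : forall a a' a'' b b' b'' (f' : Hom a' a'') (f : Hom a a')
    (g' : Hom b' b'') (g : Hom b b'),
    tensm (f' ∘ f) (g' ∘ g) = tensm f' g' ∘ tensm f g;
  assoc : forall a b c, iso (tens (tens a b) c) (tens a (tens b c));
  lunit : forall a, iso (tens munit a) a;
  runit : forall a, iso (tens a munit) a;
  braid : forall a b, iso (tens a b) (tens b a);
  assoc_nat : forall a a' b b' c c'
    (f : Hom a a') (g : Hom b b') (h : Hom c c'),
    assoc a' b' c' ∘ tensm (tensm f g) h = tensm f (tensm g h) ∘ assoc a b c;
  lunit_nat : forall a a' (f : Hom a a'),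
    lunit a' ∘ tensm (idm munit) f = f ∘ lunit a;
  runit_nat : forall a a' (f : Hom a a'),
    runit a' ∘ tensm f (idm munit) = f ∘ runit a;
  braid_nat : forall a a' b b' (f : Hom a a') (g : Hom b b'),
    braid a' b' ∘ tensm f g = tensm g f ∘ braid a b;
  pentagon : forall a b c d,
    assoc a b (tens c d) ∘ assoc (tens a b) c d =
    tensm (idm a) (assoc b c d) ∘ assoc a (tens b c) d
      ∘ tensm (assoc a b c) (idm d);
  triangle : forall a b,
    tensm (idm a) (lunit b) ∘ assoc a munit b = tensm (runit a) (idm b);
  hexagon : forall a b c,
    assoc b c a ∘ braid a (tens b c) ∘ assoc a b c =
    tensm (idm b) (braid a c) ∘ assoc b a c ∘ tensm (braid a b) (idm c);
  braidK : forall a b, braid b a ∘ braid a b = idm (tens a b)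
}.
Arguments munit {C} : rename.
Arguments tens {C} a b : rename.
Arguments tensm {C a a' b b'} f g : rename.
Arguments assoc {C} a b c : rename.
Arguments lunit {C} a : rename.
Arguments runit {C} a : rename.
Arguments braid {C} a b : rename.
Notation "a ⊗ b" := (tens a b) : cat_scope.
Notation "f ⊠ g" := (tensm f g) : cat_scope.

Definition tens_seq (C : smcat) (s : seq C) : C := foldr tens munit s.

Record smfunctor (C D : smcat) := SMFunctor {
  sfun :> functor C D;
  smF2 : forall a b, iso (sfun a ⊗ sfun b) (sfun (a ⊗ b));
  smF0 : iso munit (sfun munit);
  smF2_nat : forall a a' b b' (f : Hom a a') (g : Hom b b'),
    smF2 a' b' ∘ (fmap sfun f ⊠ fmap sfun g) = fmap sfun (f ⊠ g) ∘ smF2 a b;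
  smF2_assoc : forall a b c,
    fmap sfun (assoc a b c) ∘ smF2 (a ⊗ b) c ∘ (smF2 a b ⊠ idm (sfun c)) =
    smF2 a (b ⊗ c) ∘ (idm (sfun a) ⊠ smF2 b c)
      ∘ assoc (sfun a) (sfun b) (sfun c);
  smF2_lunit : forall a,
    fmap sfun (lunit a) ∘ smF2 munit a ∘ (smF0 ⊠ idm (sfun a)) =
    lunit (sfun a);
  smF2_runit : forall a,
    fmap sfun (runit a) ∘ smF2 a munit ∘ (idm (sfun a) ⊠ smF0) =
    runit (sfun a);
  smF2_braid : forall a b,
    fmap sfun (braid a b) ∘ smF2 a b = smF2 b a ∘ braid (sfun a) (sfun b)
}.
Arguments smF2 {C D} F a b : rename.
Arguments smF0 {C D} F : rename.

Record mnat (C D : smcat) (F G : smfunctor C D) := MNat {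
  mtr :> nat_trans F G;
  mtr_tens : forall a b, mtr (a ⊗ b) ∘ smF2 F a b = smF2 G a b ∘ (mtr a ⊠ mtr b);
  mtr_unit : mtr munit ∘ smF0 F = smF0 G
}.

Definition is_permutative (C : smcat) : Prop :=
  [/\ forall a b c : C, is_identity (assoc a b c),
      forall a : C, is_identity (lunit a) &
      forall a : C, is_identity (runit a)].

(* The symmetries are then preserved strictly, by [smF2_braid]. *)
Definition is_strict (C D : smcat) (F : smfunctor C D) : Prop :=
  (forall a b, is_identity (smF2 F a b)) /\ is_identity (smF0 F).

Lemma hom_eq_cast (C : category) (a b a' b' : C) (f : Hom a b) (f' : Hom a' b') :
  hom_eq f f' -> exists (ea : a = a') (eb : b = b'),
    f' = eq_rect b (fun y => Hom a' y) (eq_rect a (fun x => Hom x b) f a' ea) b' eb.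
Proof. by case; exists erefl, erefl. Qed.

Lemma hom_eqE (C : category) (a b : C) (f g : Hom a b) : hom_eq f g -> f = g.
Proof.
move=> /hom_eq_cast [ea [eb ->]].
by rewrite (Prop_irrelevance ea erefl) (Prop_irrelevance eb erefl).
Qed.

Lemma eq_hom_eq (C : category) (a b : C) (f g : Hom a b) : f = g -> hom_eq f g.
Proof. by move=> ->. Qed.

Lemma hom_eq_sym (C : category) (a b a' b' : C) (f : Hom a b) (f' : Hom a' b') :
  hom_eq f f' -> hom_eq f' f.
Proof. by case. Qed.

Lemma hom_eq_trans (C : category) (a b a' b' a'' b'' : C)
    (f : Hom a b) (f' : Hom a' b') (f'' : Hom a'' b'') :
  hom_eq f f' -> hom_eq f' f'' -> hom_eq f f''.
Proof. by case. Qed.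

Lemma hom_eq_fmap (C D : category) (F : functor C D) (a b a' b' : C)
    (f : Hom a b) (f' : Hom a' b') :
  hom_eq f f' -> hom_eq (fmap F f) (fmap F f').
Proof. by case. Qed.

Lemma is_identity_src (C : category) (a b : C) (f : Hom a b) :
  is_identity f -> a = b.
Proof. by case. Qed.

Lemma is_identity_id (C : category) (a : C) : is_identity (idm a).
Proof. by []. Qed.

Lemma is_identity_cmp (C : category) (a b c : C) (g : Hom b c) (f : Hom a b) :
  is_identity f -> is_identity g -> is_identity (g ∘ f).
Proof.
by move=> h; case: h g => g ?; rewrite cmpm1.
Qed.

Lemma is_identity_fmap (C D : category) (F : functor C D) (a b : C) (f : Hom a b) :
  is_identity f -> is_identity (fmap F f).
Proof. by case; rewrite fmap1. Qed.

Lemma is_identity_fmap_cmp (C D : category) (F : functor C D) (a b c : C)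
    (g : Hom b c) (f : Hom a b) :
  is_identity (fmap F f) -> is_identity (fmap F g) -> is_identity (fmap F (g ∘ f)).
Proof. by rewrite fmapM; apply: is_identity_cmp. Qed.

Lemma is_identity_tensm (C : smcat) (a a' b b' : C) (f : Hom a a') (g : Hom b b') :
  is_identity f -> is_identity g -> is_identity (f ⊠ g).
Proof. by case; case; rewrite tensm1. Qed.

Lemma is_identity_iso (C : category) (a b : C) (f : Hom a b) :
  is_identity f -> is_iso f.
Proof. by case; exists (idm a); rewrite cmp1m. Qed.

Lemma is_identity_hom_eq (C : category) (a b a' b' : C)
    (f : Hom a b) (f' : Hom a' b') :
  is_identity f -> is_identity f' -> a = a' -> hom_eq f f'.
Proof. by case; case=> e; case: _ / e. Qed.

Lemma iso_eq (C : category) (a b : C) (f g : iso a b) : fwd f = fwd g -> f = g.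
Proof.
case: f g => [f f' fK Kf] [g g' gK Kg] /= e.
move: e fK Kf => -> fK Kf.
have e : f' = g' by rewrite -[LHS]cmpm1 -Kg cmpA fK cmp1m.
move: e fK Kf => -> fK Kf.
by rewrite (Prop_irrelevance fK gK) (Prop_irrelevance Kf Kg).
Qed.

Lemma is_iso_iso (C : category) (a b : C) (f : iso a b) : is_iso f.
Proof. by exists (bwd f); rewrite fwdK bwdK. Qed.

Lemma is_iso_id (C : category) (a : C) : is_iso (idm a).
Proof. by exists (idm a); rewrite cmp1m. Qed.

Lemma is_iso_cmp (C : category) (a b c : C) (g : Hom b c) (f : Hom a b) :
  is_iso g -> is_iso f -> is_iso (g ∘ f).
Proof.
move=> [g' [gK Kg]] [f' [fK Kf]]; exists (f' ∘ g').
by rewrite -!cmpA (cmpA g') gK cmp1m fK (cmpA f) Kf cmp1m Kg.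
Qed.

Lemma is_iso_fmap (C D : category) (F : functor C D) (a b : C) (f : Hom a b) :
  is_iso f -> is_iso (fmap F f).
Proof. by move=> [g [gK Kg]]; exists (fmap F g); rewrite -!fmapM gK Kg !fmap1. Qed.

Lemma is_iso_cancell (C : category) (a b c : C) (g : Hom b c) (f : Hom a b) :
  is_iso g -> is_iso (g ∘ f) -> is_iso f.
Proof.
move=> [g' [gK Kg]] [k [kK Kk]].
have -> : f = g' ∘ (g ∘ f) by rewrite cmpA gK cmp1m.
apply: is_iso_cmp; first by exists g.
by exists k.
Qed.

Lemma is_iso_cancelr (C : category) (a b c : C) (g : Hom b c) (f : Hom a b) :
  is_iso f -> is_iso (g ∘ f) -> is_iso g.
Proof.
move=> [f' [fK Kf]] [k [kK Kk]].
have -> : g = g ∘ f ∘ f' by rewrite -cmpA Kf cmpm1.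
apply: is_iso_cmp; last by exists f.
by exists k.
Qed.

Lemma functor_eq (C D : category) (F G : functor C D) :
  (forall a, F a = G a) ->
  (forall a b (f : Hom a b), hom_eq (fmap F f) (fmap G f)) -> F = G.
Proof.
case: F G => [F mF F1 FM] [G mG G1 GM] /= eob emap.
have e : F = G by apply: functional_extensionality_dep.
case: _ / e in mG G1 GM emap {eob} *.
have e : mF = mG.
  do 3 apply: functional_extensionality_dep => ?.
  exact/hom_eqE.
case: _ / e in G1 GM {emap} *.
by rewrite (Prop_irrelevance F1 G1) (Prop_irrelevance FM GM).
Qed.

Lemma smfunctor_eq (C D : smcat) (F G : smfunctor C D) :
  sfun F = sfun G ->
  (forall a b, hom_eq (smF2 F a b) (smF2 G a b)) ->
  hom_eq (smF0 F) (smF0 G) -> F = G.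
Proof.
case: F G => [F F2 F0 p1 p2 p3 p4 p5] [G G2 G0 q1 q2 q3 q4 q5] /= e.
case: _ / e in G2 G0 q1 q2 q3 q4 q5 * => e2 e0.
have e : F2 = G2.
  by do 2 apply: functional_extensionality_dep => ?; apply/iso_eq/hom_eqE.
case: _ / e in q1 q2 q3 q4 q5 {e2} *.
have e : F0 = G0 by apply/iso_eq/hom_eqE.
case: _ / e in q1 q2 q3 q4 q5 {e0} *.
by congr SMFunctor; apply: Prop_irrelevance.
Qed.

Lemma nat_trans_eq (C D : category) (F G : functor C D) (s t : nat_trans F G) :
  (forall a, s a = t a) -> s = t.
Proof.
case: s t => [s p] [t q] /= e.
have {}e : s = t by apply: functional_extensionality_dep.
by case: _ / e in q *; rewrite (Prop_irrelevance p q).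
Qed.

Lemma mnat_eq (C D : smcat) (F G : smfunctor C D) (s t : mnat F G) :
  (forall a, s a = t a) -> s = t.
Proof.
case: s t => [s p p'] [t q q'] /= e.
have {}e : s = t by apply: nat_trans_eq.
by case: _ / e in q q' *; congr MNat; apply: Prop_irrelevance.
Qed.

(* A collection of finite sets, containing up to bijection all finite sets and
   carrying a choice of empty set and of binary coproducts. It serves to treat
   at once Csp (all finite sets, with disjoint union) and C( * ) (the finite
   sets [n], with ordinal sum); all objects and all apices of cospans are taken
   in the collection. *)
Record fin_universe := FinUniverse {
  code :> Type;
  El : code -> finType;
  El_full : forall X : finType, exists (u : code) (f : X -> El u), bijective f;
  ezero : code;
  El_zero : El ezero -> False;
  eplus : code -> code -> code;
  ein : forall u v, El u + El v -> El (eplus u v);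
  eout : forall u v, El (eplus u v) -> El u + El v;
  einK : forall u v, cancel (@ein u v) (@eout u v);
  eoutK : forall u v, cancel (@eout u v) (@ein u v)
}.
Arguments ezero {f} : rename.
Arguments ein {f u v} x : rename.
Arguments eout {f u v} x : rename.

Lemma finset_full (X : finType) : exists (u : finType) (f : X -> u), bijective f.
Proof. by exists X, id; exists id. Qed.

Lemma ordinal_full (X : finType) : exists (n : nat) (f : X -> 'I_n), bijective f.
Proof. by exists #|X|, enum_rank; apply: enum_rank_bij. Qed.

Lemma ord_zero (i : 'I_0) : False.
Proof. by case: i. Qed.

Definition finset_universe : fin_universe :=
  @FinUniverse finType id finset_full
    void (fun x => match x with end)
    (fun X Y => (X + Y)%type) (fun _ _ => id) (fun _ _ => id)
    (fun _ _ _ => erefl) (fun _ _ _ => erefl).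

Definition ordinal_universe : fin_universe :=
  @FinUniverse nat (fun n => 'I_n) ordinal_full
    0 ord_zero
    addn (fun m n => @unsplit m n) (fun m n => @split m n)
    (fun m n => @unsplitK m n) (fun m n => @splitK m n).

Section Sums.
Variable U : fin_universe.
Implicit Types A B C D : U.

Definition einl A B (a : El A) : El (eplus A B) := ein (inl a).
Definition einr A B (b : El B) : El (eplus A B) := ein (inr b).
Definition ecase A B (T : Type) (f : El A -> T) (g : El B -> T)
    (x : El (eplus A B)) : T :=
  match eout x with inl a => f a | inr b => g b end.
Definition emap A A' B B' (f : El A -> El A') (g : El B -> El B') :
    El (eplus A B) -> El (eplus A' B') :=
  ecase (fun a => einl B' (f a)) (fun b => einr A' (g b)).

Lemma ecasel A B (T : Type) (f : El A -> T) (g : El B -> T) a :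
  ecase f g (einl B a) = f a.
Proof. by rewrite /ecase /einl einK. Qed.

Lemma ecaser A B (T : Type) (f : El A -> T) (g : El B -> T) b :
  ecase f g (einr A b) = g b.
Proof. by rewrite /ecase /einr einK. Qed.

Lemma emapl A A' B B' (f : El A -> El A') (g : El B -> El B') a :
  emap f g (einl B a) = einl B' (f a).
Proof. exact: ecasel. Qed.

Lemma emapr A A' B B' (f : El A -> El A') (g : El B -> El B') b :
  emap f g (einr A b) = einr A' (g b).
Proof. exact: ecaser. Qed.

Definition eE := (ecasel, ecaser, emapl, emapr).

Lemma esum_ind A B (P : El (eplus A B) -> Prop) :
  (forall a, P (einl B a)) -> (forall b, P (einr A b)) -> forall x, P x.
Proof.
by move=> Pl Pr x; rewrite -(eoutK x); case: (eout x) => [a|b];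
  [apply: Pl | apply: Pr].
Qed.

Lemma einl_inj A B : injective (@einl A B).
Proof. by move=> x y /(can_inj (@einK _ _ _)) []. Qed.

Lemma einr_inj A B : injective (@einr A B).
Proof. by move=> x y /(can_inj (@einK _ _ _)) []. Qed.

Lemma einlr A B a b : @einl A B a <> @einr A B b.
Proof. by move=> /(can_inj (@einK _ _ _)). Qed.

Definition eassoc A B C : El (eplus (eplus A B) C) -> El (eplus A (eplus B C)) :=
  ecase (ecase (@einl A _) (fun b => einr A (einl C b)))
        (fun c => einr A (einr B c)).
Definition eassoc' A B C : El (eplus A (eplus B C)) -> El (eplus (eplus A B) C) :=
  ecase (fun a => einl C (einl B a))
        (ecase (fun b => einl C (einr A b)) (@einr (eplus A B) C)).
Definition eswap A B : El (eplus A B) -> El (eplus B A) :=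
  ecase (@einr B A) (@einl B A).
Definition elunit A : El (eplus ezero A) -> El A :=
  ecase (fun z => match El_zero z with end) id.
Definition erunit A : El (eplus A ezero) -> El A :=
  ecase id (fun z => match El_zero z with end).

Lemma eassocK A B C : cancel (@eassoc A B C) (@eassoc' A B C).
Proof.
by elim/esum_ind => [|c]; [elim/esum_ind => x|]; rewrite /eassoc /eassoc' !eE.
Qed.

Lemma eassocVK A B C : cancel (@eassoc' A B C) (@eassoc A B C).
Proof.
by elim/esum_ind => [a|]; [|elim/esum_ind => x]; rewrite /eassoc /eassoc' !eE.
Qed.

Lemma eswapK A B : cancel (@eswap A B) (@eswap B A).
Proof. by elim/esum_ind => x; rewrite /eswap !eE. Qed.

Lemma elunitK A : cancel (@elunit A) (@einr ezero A).
Proof. by elim/esum_ind => x; [case: (El_zero x)|rewrite /elunit eE]. Qed.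

Lemma elunitVK A : cancel (@einr ezero A) (@elunit A).
Proof. by move=> x; rewrite /elunit eE. Qed.

Lemma erunitK A : cancel (@erunit A) (@einl A ezero).
Proof. by elim/esum_ind => x; [rewrite /erunit eE|case: (El_zero x)]. Qed.

Lemma erunitVK A : cancel (@einl A ezero) (@erunit A).
Proof. by move=> x; rewrite /erunit eE. Qed.

Lemma emapK A A' B B' (f : El A -> El A') f' (g : El B -> El B') g' :
  cancel f f' -> cancel g g' -> cancel (emap f g) (emap f' g').
Proof. by move=> fK gK; elim/esum_ind => x; rewrite !eE ?fK ?gK. Qed.

End Sums.

Section Pushouts.

Record is_pushout (B X Y P : finType)
    (f : B -> X) (g : B -> Y) (i : X -> P) (j : Y -> P) : Prop := IsPushout {
  po_sq : forall b, i (f b) = j (g b);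
  po_desc : forall (T : finType) (u : X -> T) (v : Y -> T),
    (forall b, u (f b) = v (g b)) ->
    exists h : P -> T, (forall x, h (i x) = u x) /\ (forall y, h (j y) = v y);
  po_uniq : forall (T : finType) (h h' : P -> T),
    (forall x, h (i x) = h' (i x)) -> (forall y, h (j y) = h' (j y)) ->
    forall p, h p = h' p
}.

Lemma pushout_exists (B X Y : finType) (f : B -> X) (g : B -> Y) :
  exists (P : finType) (i : X -> P) (j : Y -> P), is_pushout f g i j.
Proof.
pose e : rel (X + Y)%type := fun s t =>
  [exists b, ((s == inl (f b)) && (t == inr (g b)))
          || ((t == inl (f b)) && (s == inr (g b)))].
have e_sym : symmetric e.
  by move=> s t; apply/eq_existsb => b; rewrite orbC.
have csym : connect_sym e by apply: sym_connect_sym.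
pose P : finType := {s : (X + Y)%type | roots e s}.
pose q (s : X + Y) : P := Sub (fingraph.root e s) (roots_root csym s).
have qE s t : connect e s t -> q s = q t.
  by move=> st; apply: val_inj => /=; apply/eqP; rewrite root_connect.
have qval (p : P) : q (val p) = p.
  by apply: val_inj => /=; apply/eqP; exact: (valP p).
exists P, (fun x => q (inl x)), (fun y => q (inr y)); split.
- move=> b; apply/qE/connect1/existsP; exists b.
  by rewrite !eqxx.
- move=> T u v uv.
  pose w (s : X + Y) := match s with inl x => u x | inr y => v y end.
  have wE s t : connect e s t -> w s = w t.
    move=> /connectP [p]; elim: p s => [|r p IH] s /=; first by move=> _ ->.
    move=> /andP [sr rp] tE; rewrite -(IH r rp tE).
    by case/existsP: sr => b /orP [] /andP [/eqP -> /eqP ->] /=.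
  exists (fun p => w (val p)).
  split=> z.
    by apply/esym/(wE (inl z)); rewrite /= connect_root.
  by apply/esym/(wE (inr z)); rewrite /= connect_root.
- move=> T h h' hi hj p; rewrite -(qval p).
  by case: (val p) => [x|y].
Qed.

Lemma pushout_unique (B X Y P P' : finType) (f : B -> X) (g : B -> Y)
    (i : X -> P) (j : Y -> P) (i' : X -> P') (j' : Y -> P') :
  is_pushout f g i j -> is_pushout f g i' j' ->
  exists h : P -> P', [/\ bijective h, forall x, h (i x) = i' x
                        & forall y, h (j y) = j' y].
Proof.
move=> [sq ds un] [sq' ds' un'].
have [h [hi hj]] := ds _ _ _ sq'.
have [h' [hi' hj']] := ds' _ _ _ sq.
exists h; split=> //; exists h'.
  by apply: (un _ (fun p => h' (h p)) id) => z; rewrite ?hi ?hj ?hi' ?hj'.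
by apply: (un' _ (fun p => h (h' p)) id) => z; rewrite ?hi' ?hj' ?hi ?hj.
Qed.

Lemma pushout_iso (B X X' Y Y' P P' : finType) (f : B -> X) (g : B -> Y)
    (i : X -> P) (j : Y -> P) (s : X -> X') (t : Y -> Y') (r : P -> P')
    (f' : B -> X') (g' : B -> Y') (i' : X' -> P') (j' : Y' -> P') :
  bijective s -> bijective t -> bijective r ->
  (forall b, s (f b) = f' b) -> (forall b, t (g b) = g' b) ->
  (forall x, i' (s x) = r (i x)) -> (forall y, j' (t y) = r (j y)) ->
  is_pushout f g i j -> is_pushout f' g' i' j'.
Proof.
move=> [s' sK Ks] [t' tK Kt] [r' rK Kr] fE gE iE jE [sq ds un]; split.
- by move=> b; rewrite -fE -gE iE jE sq.
- move=> T u v uv.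
  have [|h [hi hj]] := ds T (fun x => u (s x)) (fun y => v (t y)).
    by move=> b; rewrite fE gE.
  exists (fun p => h (r' p)); split=> z.
    by rewrite -{1}(Ks z) iE rK hi Ks.
  by rewrite -{1}(Kt z) jE rK hj Kt.
- move=> T h h' hi hj p; rewrite -(Kr p).
  apply: (un T (fun p => h (r p)) (fun p => h' (r p))) => z.
    by rewrite -iE hi.
  by rewrite -jE hj.
Qed.

End Pushouts.

Section Cospans.
Variable U : fin_universe.
Implicit Types A B C D : U.

Record cospan A B := Cospan {
  apex : U;
  lleg : El A -> El apex;
  rleg : El B -> El apex
}.

Definition cospan_iso A B (x y : cospan A B) : Prop :=
  exists h : El (apex x) -> El (apex y),
    [/\ bijective h, forall a, h (lleg x a) = lleg y a
      & forall b, h (rleg x b) = rleg y b].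

(* The morphisms are isomorphism classes, as sets of cospans. *)
Record cospan_class A B := CospanClass {
  mem_class :> cospan A B -> Prop;
  _ : exists x, forall y, mem_class y <-> cospan_iso x y
}.

Lemma cospan_iso_refl A B (x : cospan A B) : cospan_iso x x.
Proof. by exists id; split=> //; exists id. Qed.

Lemma cospan_iso_sym A B (x y : cospan A B) : cospan_iso x y -> cospan_iso y x.
Proof.
move=> [h [[h' hK Kh] hl hr]]; exists h'; split; first by exists h.
  by move=> a; rewrite -hl hK.
by move=> b; rewrite -hr hK.
Qed.

Lemma cospan_iso_trans A B (x y z : cospan A B) :
  cospan_iso x y -> cospan_iso y z -> cospan_iso x z.
Proof.
move=> [h [hb hl hr]] [k [kb kl kr]]; exists (fun p => k (h p)); split.
- exact: (bij_comp kb hb).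
- by move=> a; rewrite hl kl.
- by move=> b; rewrite hr kr.
Qed.

Definition class_of A B (x : cospan A B) : cospan_class A B :=
  @CospanClass A B (cospan_iso x)
    (ex_intro _ x (fun y => conj (fun h => h) (fun h => h))).

Lemma class_eq A B (P Q : cospan_class A B) : (forall x, P x <-> Q x) -> P = Q.
Proof.
case: P Q => [P p] [Q q] /= PQ.
have e : P = Q by apply: functional_extensionality_dep => x; apply/propext.
by case: _ / e in q PQ *; rewrite (Prop_irrelevance p q).
Qed.

Lemma class_ofP A B (P : cospan_class A B) : exists x, P = class_of x.
Proof. by case: (P) => Q [x xP]; exists x; apply: class_eq. Qed.

Lemma class_of_eq A B (x y : cospan A B) :
  class_of x = class_of y <-> cospan_iso x y.
Proof.
split=> [e|xy].
  by have : class_of x y by rewrite e; apply: cospan_iso_refl.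
apply: class_eq => z; split; first exact/cospan_iso_trans/cospan_iso_sym.
exact/cospan_iso_trans.
Qed.

Lemma class_of_mem A B (P : cospan_class A B) (x : cospan A B) :
  P x -> P = class_of x.
Proof. by have [y ->] := class_ofP P => /class_of_eq. Qed.

(* [z] is a composite of [x] followed by [y], through some pushout of the inner
   legs. *)
Definition is_composite A B C (x : cospan A B) (y : cospan B C)
    (z : cospan A C) : Prop :=
  exists (i : El (apex x) -> El (apex z)) (j : El (apex y) -> El (apex z)),
    [/\ is_pushout (@rleg _ _ x) (@lleg _ _ y) i j,
        forall a, lleg z a = i (lleg x a)
      & forall c, rleg z c = j (rleg y c)].

Lemma composite_exists A B C (x : cospan A B) (y : cospan B C) :
  exists z, is_composite x y z.
Proof.
have [P [i [j ij]]] := pushout_exists (@rleg _ _ x) (@lleg _ _ y).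
have [u [r rb]] := El_full U P.
exists (@Cospan A C u (fun a => r (i (lleg x a))) (fun c => r (j (rleg y c)))).
exists (fun p => r (i p)), (fun p => r (j p)); split=> //=.
by apply: (pushout_iso (s := id) (t := id) _ _ rb _ _ _ _ ij) => //;
  exists id.
Qed.

Lemma composite_iso A B C (x x' : cospan A B) (y y' : cospan B C) z z' :
  cospan_iso x x' -> cospan_iso y y' -> cospan_iso z z' ->
  is_composite x y z -> is_composite x' y' z'.
Proof.
move=> [s [sb sl sr]] [t [tb tl tr]] [r [rb rl rr]] [i [j [po zl zr]]].
case: (sb) (tb) => s' sK Ks [t' tK Kt].
exists (fun p => r (i (s' p))), (fun p => r (j (t' p))); split.
- by apply: (pushout_iso sb tb rb _ _ _ _ po) => // p; rewrite ?sK ?tK.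
- by move=> a; rewrite -rl zl -sl sK.
- by move=> c; rewrite -rr zr -tr tK.
Qed.

Lemma composite_unique A B C (x : cospan A B) (y : cospan B C) z z' :
  is_composite x y z -> is_composite x y z' -> cospan_iso z z'.
Proof.
move=> [i [j [po zl zr]]] [i' [j' [po' zl' zr']]].
have [h [hb hi hj]] := pushout_unique po po'.
exists h; split=> // a; first by rewrite zl zl' hi.
by rewrite zr zr' hj.
Qed.

Lemma class_cmp_subproof A B C (Q : cospan_class B C) (P : cospan_class A B) :
  exists z, forall z',
    (exists x y, [/\ P x, Q y & is_composite x y z']) <-> cospan_iso z z'.
Proof.
have [x ->] := class_ofP P; have [y ->] := class_ofP Q.
have [z xyz] := composite_exists x y.
exists z => z'; split=> [[x' [y' [xx' yy' xyz']]]|zz'].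
  by apply: (composite_unique (composite_iso xx' yy' (cospan_iso_refl _) xyz)).
exists x, y; split; try exact: cospan_iso_refl.
by apply: composite_iso xyz => //; apply: cospan_iso_refl.
Qed.

Definition class_cmp A B C (Q : cospan_class B C) (P : cospan_class A B) :
    cospan_class A C :=
  CospanClass (class_cmp_subproof Q P).

Lemma class_cmpE A B C (x : cospan A B) (y : cospan B C) z :
  is_composite x y z -> class_cmp (class_of y) (class_of x) = class_of z.
Proof.
move=> xyz; apply: class_of_mem.
by exists x, y; split=> //; apply: cospan_iso_refl.
Qed.

Lemma composite_assoc A B C D (x : cospan A B) (y : cospan B C) (w : cospan C D)
    z1 z2 z3 :
  is_composite x y z1 -> is_composite z1 w z2 -> is_composite y w z3 ->
  is_composite x z3 z2.
Proof.
move=> [i1 [j1 [[sq1 ds1 un1] l1 r1]]] [i2 [j2 [[sq2 ds2 un2] l2 r2]]].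
move=> [i3 [j3 [[sq3 ds3 un3] l3 r3]]].
have [|k [ki kj]] := ds3 _ (fun p => i2 (j1 p)) j2.
  by move=> c; rewrite -r1 sq2.
exists (fun p => i2 (i1 p)), k; split.
- split.
  + by move=> b; rewrite l3 ki sq1.
  + move=> T u v uv.
    have [|h1 [h1i h1j]] := ds1 T u (fun p => v (i3 p)).
      by move=> b; rewrite uv l3.
    have [|h2 [h2i h2j]] := ds2 T h1 (fun p => v (j3 p)).
      by move=> c; rewrite r1 h1j sq3.
    exists h2; split=> [p|]; first by rewrite h2i.
    apply: (un3 _ (fun p => h2 (k p)) v) => p; first by rewrite ki h2i h1j.
    by rewrite kj h2j.
  + move=> T h h' hi hk; apply: un2 => [|p]; last by rewrite -kj hk.
    apply: (un1 _ (fun p => h (i2 p)) (fun p => h' (i2 p))) => // p.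
    by rewrite -ki hk.
- by move=> a; rewrite l2 l1.
- by move=> d; rewrite r3 kj r2.
Qed.

Definition graph A B (f : El A -> El B) : cospan A B := @Cospan A B B f id.

Lemma composite_graphl A' A B (f : El A' -> El A) (x : cospan A B) :
  is_composite (graph f) x (@Cospan A' B (apex x) (fun a => lleg x (f a)) (@rleg _ _ x)).
Proof.
exists (@lleg _ _ x), id; split=> //=; split=> //.
by move=> T u v uv; exists v; split=> // p; rewrite uv.
Qed.

Lemma composite_graphr A B B' (g : El B -> El B') (g' : El B' -> El B)
    (x : cospan A B) : cancel g g' -> cancel g' g ->
  is_composite x (graph g) (@Cospan A B' (apex x) (@lleg _ _ x) (fun b => rleg x (g' b))).
Proof.
move=> gK Kg; exists id, (fun b => rleg x (g' b)); split=> //=; split=> //.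
  by move=> b /=; rewrite gK.
by move=> T u v uv; exists u; split=> // b; rewrite uv /= Kg.
Qed.

Definition class_graph A B (f : El A -> El B) : cospan_class A B :=
  class_of (graph f).

Lemma class_cmp1m A B (P : cospan_class A B) : class_cmp (class_graph id) P = P.
Proof.
have [x ->] := class_ofP P.
rewrite (class_cmpE (composite_graphr (g' := id) _ _ _)) //.
by case: x.
Qed.

Lemma class_cmpm1 A B (P : cospan_class A B) : class_cmp P (class_graph id) = P.
Proof.
have [x ->] := class_ofP P.
by rewrite (class_cmpE (composite_graphl _ _)); case: x.
Qed.

Lemma class_cmpA A B C D (R : cospan_class C D) (Q : cospan_class B C)
    (P : cospan_class A B) :
  class_cmp R (class_cmp Q P) = class_cmp (class_cmp R Q) P.
Proof.
have [x ->] := class_ofP P; have [y ->] := class_ofP Q.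
have [w ->] := class_ofP R.
have [z1 h1] := composite_exists x y.
have [z2 h2] := composite_exists z1 w.
have [z3 h3] := composite_exists y w.
rewrite (class_cmpE h1) (class_cmpE h2) (class_cmpE h3).
by rewrite (class_cmpE (composite_assoc h1 h2 h3)).
Qed.

Definition csp_category : category :=
  @Category U cospan_class (fun A => class_graph id) class_cmp
    class_cmpA class_cmp1m class_cmpm1.

Definition cospan_sum A A' B B' (x : cospan A A') (y : cospan B B') :
    cospan (eplus A B) (eplus A' B') :=
  @Cospan (eplus A B) (eplus A' B') (eplus (apex x) (apex y))
    (emap (@lleg _ _ x) (@lleg _ _ y)) (emap (@rleg _ _ x) (@rleg _ _ y)).

Lemma cospan_sum_iso A A' B B' (x x' : cospan A A') (y y' : cospan B B') :
  cospan_iso x x' -> cospan_iso y y' ->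
  cospan_iso (cospan_sum x y) (cospan_sum x' y').
Proof.
move=> [s [[s' sK Ks] sl sr]] [t [[t' tK Kt] tl tr]].
exists (emap s t); split.
- by exists (emap s' t'); apply: emapK.
- by elim/esum_ind => p /=; rewrite !eE ?sl ?tl.
- by elim/esum_ind => p /=; rewrite !eE ?sr ?tr.
Qed.

Lemma class_sum_subproof A A' B B' (P : cospan_class A A')
    (Q : cospan_class B B') :
  exists z, forall z',
    (exists x y, [/\ P x, Q y & cospan_iso (cospan_sum x y) z']) <->
    cospan_iso z z'.
Proof.
have [x ->] := class_ofP P; have [y ->] := class_ofP Q.
exists (cospan_sum x y) => z'; split=> [[x' [y' [xx' yy']]]|xyz].
  by apply: cospan_iso_trans; apply: cospan_sum_iso.
by exists x, y; split=> //; apply: cospan_iso_refl.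
Qed.

Definition class_sum A A' B B' (P : cospan_class A A') (Q : cospan_class B B') :
    cospan_class (eplus A B) (eplus A' B') :=
  CospanClass (class_sum_subproof P Q).

Lemma class_sumE A A' B B' (x : cospan A A') (y : cospan B B') :
  class_sum (class_of x) (class_of y) = class_of (cospan_sum x y).
Proof.
apply: class_of_mem; exists x, y; split; exact: cospan_iso_refl.
Qed.

Lemma composite_sum A A' A'' B B' B'' (x : cospan A A') (x' : cospan A' A'')
    (y : cospan B B') (y' : cospan B' B'') z w :
  is_composite x x' z -> is_composite y y' w ->
  is_composite (cospan_sum x y) (cospan_sum x' y') (cospan_sum z w).
Proof.
move=> [i [j [[sq ds un] l r]]] [i' [j' [[sq' ds' un'] l' r']]].
exists (emap i i'), (emap j j'); split; last 2 first.
- by elim/esum_ind => p /=; rewrite !eE ?l ?l'.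
- by elim/esum_ind => p /=; rewrite !eE ?r ?r'.
split.
- by elim/esum_ind => p /=; rewrite !eE ?sq ?sq'.
- move=> T u v uv.
  have [|h [hi hj]] := ds T (fun p => u (einl _ p)) (fun p => v (einl _ p)).
    by move=> b; have := uv (einl _ b); rewrite /= !eE.
  have [|h' [hi' hj']] := ds' T (fun p => u (einr _ p)) (fun p => v (einr _ p)).
    by move=> b; have := uv (einr _ b); rewrite /= !eE.
  by exists (ecase h h'); split; elim/esum_ind => p;
    rewrite !eE ?hi ?hj ?hi' ?hj'.
- move=> T h h' hi hj; elim/esum_ind => p.
    apply: (un _ (fun p => h (einl _ p)) (fun p => h' (einl _ p))) => q.
      by have := hi (einl _ q); rewrite !eE.
    by have := hj (einl _ q); rewrite !eE.
  apply: (un' _ (fun p => h (einr _ p)) (fun p => h' (einr _ p))) => q.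
    by have := hi (einr _ q); rewrite !eE.
  by have := hj (einr _ q); rewrite !eE.
Qed.

Lemma graph_eq A B (f g : El A -> El B) : f =1 g -> class_graph f = class_graph g.
Proof.
by move=> fg; have -> : f = g by apply: functional_extensionality_dep.
Qed.

Lemma graph_cmp A B C (g : El B -> El C) (f : El A -> El B) :
  class_cmp (class_graph g) (class_graph f) = class_graph (fun a => g (f a)).
Proof. exact: (class_cmpE (composite_graphl _ _)). Qed.

Lemma graph_sum A A' B B' (f : El A -> El A') (g : El B -> El B') :
  class_sum (class_graph f) (class_graph g) = class_graph (emap f g).
Proof.
rewrite class_sumE; apply/class_of_eq.
by exists id; split=> [|//|]; [exists id|elim/esum_ind => p /=; rewrite eE].
Qed.

Lemma graph_iso_subproof A B (f : El A -> El B) (g : El B -> El A) :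
  cancel f g -> class_cmp (class_graph g) (class_graph f) = class_graph id.
Proof. by move=> fK; rewrite graph_cmp; apply: graph_eq. Qed.

Definition graph_iso A B (f : El A -> El B) (g : El B -> El A)
    (fK : cancel f g) (gK : cancel g f) : @iso csp_category A B :=
  @Iso csp_category A B (class_graph f) (class_graph g)
    (graph_iso_subproof fK) (graph_iso_subproof gK).

Lemma graph_nat A A' B B' (f : El A -> El A')
    (g : El B -> El B') (g' : El B' -> El B) (x : cospan A B) (x' : cospan A' B')
    (h : El (apex x) -> El (apex x')) :
  cancel g g' -> cancel g' g -> bijective h ->
  (forall a, h (lleg x a) = lleg x' (f a)) ->
  (forall b, h (rleg x b) = rleg x' (g b)) ->
  class_cmp (class_graph g) (class_of x) = class_cmp (class_of x') (class_graph f).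
Proof.
move=> gK Kg hb hl hr.
rewrite (class_cmpE (composite_graphr _ gK Kg)) (class_cmpE (composite_graphl _ _)).
apply/class_of_eq; exists h; split=> //= b.
by rewrite hr Kg.
Qed.

Lemma class_sum1 A B :
  class_sum (class_graph (@id (El A))) (class_graph (@id (El B))) = class_graph id.
Proof. by rewrite graph_sum; apply: graph_eq; elim/esum_ind => p; rewrite eE. Qed.

Lemma class_sumM A A' A'' B B' B'' (P' : cospan_class A' A'')
    (P : cospan_class A A') (Q' : cospan_class B' B'') (Q : cospan_class B B') :
  class_sum (class_cmp P' P) (class_cmp Q' Q) =
  class_cmp (class_sum P' Q') (class_sum P Q).
Proof.
have [x ->] := class_ofP P; have [x' ->] := class_ofP P'.
have [y ->] := class_ofP Q; have [y' ->] := class_ofP Q'.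
have [z hz] := composite_exists x x'; have [w hw] := composite_exists y y'.
rewrite (class_cmpE hz) (class_cmpE hw) !class_sumE.
by rewrite (class_cmpE (composite_sum hz hw)).
Qed.

Definition csp_assoc A B C := graph_iso (@eassocK U A B C) (@eassocVK U A B C).
Definition csp_lunit A := graph_iso (@elunitK U A) (@elunitVK U A).
Definition csp_runit A := graph_iso (@erunitK U A) (@erunitVK U A).
Definition csp_braid A B := graph_iso (@eswapK U A B) (@eswapK U B A).

Lemma csp_assoc_nat A A' B B' C C' (P : cospan_class A A')
    (Q : cospan_class B B') (R : cospan_class C C') :
  class_cmp (fwd (csp_assoc A' B' C')) (class_sum (class_sum P Q) R) =
  class_cmp (class_sum P (class_sum Q R)) (fwd (csp_assoc A B C)).
Proof.
have [x ->] := class_ofP P; have [y ->] := class_ofP Q.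
have [z ->] := class_ofP R; rewrite !class_sumE.
rewrite /=; apply: (graph_nat (@eassocK _ _ _ _) (@eassocVK _ _ _ _)
  
  (x := cospan_sum (cospan_sum x y) z)
  (x' := cospan_sum x (cospan_sum y z))
  (h := @eassoc _ _ _ _)).
- by exists (@eassoc' _ _ _ _); [apply: eassocK|apply: eassocVK].
- by elim/esum_ind => [|c]; [elim/esum_ind => p|]; rewrite /eassoc /= !eE.
- by elim/esum_ind => [|c]; [elim/esum_ind => p|]; rewrite /eassoc /= !eE.
Qed.

Lemma csp_lunit_nat A A' (P : cospan_class A A') :
  class_cmp (fwd (csp_lunit A')) (class_sum (class_graph (@id (El ezero))) P) =
  class_cmp P (fwd (csp_lunit A)).
Proof.
have [x ->] := class_ofP P; rewrite class_sumE.
rewrite /=; apply: (graph_nat (@elunitK _ _) (@elunitVK _ _) 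
  (x := cospan_sum (graph (@id (El ezero))) x)
  (x' := x)
  (h := @elunit _ _)).
- by exists (@einr _ _ _); [apply: elunitK|apply: elunitVK].
- by elim/esum_ind => p; [case: (El_zero p)|rewrite /elunit /= !eE].
- by elim/esum_ind => p; [case: (El_zero p)|rewrite /elunit /= !eE].
Qed.

Lemma csp_runit_nat A A' (P : cospan_class A A') :
  class_cmp (fwd (csp_runit A')) (class_sum P (class_graph (@id (El ezero)))) =
  class_cmp P (fwd (csp_runit A)).
Proof.
have [x ->] := class_ofP P; rewrite class_sumE.
rewrite /=; apply: (graph_nat (@erunitK _ _) (@erunitVK _ _) 
  (x := cospan_sum x (graph (@id (El ezero))))
  (x' := x)
  (h := @erunit _ _)).
- by exists (@einl _ _ _); [apply: erunitK|apply: erunitVK].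
- by elim/esum_ind => p; [rewrite /erunit /= !eE|case: (El_zero p)].
- by elim/esum_ind => p; [rewrite /erunit /= !eE|case: (El_zero p)].
Qed.

Lemma csp_braid_nat A A' B B' (P : cospan_class A A') (Q : cospan_class B B') :
  class_cmp (fwd (csp_braid A' B')) (class_sum P Q) =
  class_cmp (class_sum Q P) (fwd (csp_braid A B)).
Proof.
have [x ->] := class_ofP P; have [y ->] := class_ofP Q; rewrite !class_sumE.
rewrite /=; apply: (graph_nat (@eswapK _ _ _) (@eswapK _ _ _) 
  (x := cospan_sum x y)
  (x' := cospan_sum y x)
  (h := @eswap _ _ _)).
- by exists (@eswap _ _ _); apply: eswapK.
- by elim/esum_ind => p; rewrite /eswap /= !eE.
- by elim/esum_ind => p; rewrite /eswap /= !eE.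
Qed.

Lemma csp_pentagon A B C D :
  class_cmp (fwd (csp_assoc A B (eplus C D))) (fwd (csp_assoc (eplus A B) C D)) =
  class_cmp (class_cmp (class_sum (class_graph id) (fwd (csp_assoc B C D)))
                       (fwd (csp_assoc A (eplus B C) D)))
            (class_sum (fwd (csp_assoc A B C)) (class_graph id)).
Proof.
rewrite /= !graph_sum !graph_cmp; apply: graph_eq.
by elim/esum_ind => [|d]; [elim/esum_ind => [|c]; [elim/esum_ind => p|]|];
  rewrite /eassoc !eE.
Qed.

Lemma csp_triangle A B :
  class_cmp (class_sum (class_graph id) (fwd (csp_lunit B))) (fwd (csp_assoc A ezero B)) =
  class_sum (fwd (csp_runit A)) (class_graph id).
Proof.
rewrite /= !graph_sum !graph_cmp; apply: graph_eq.
by elim/esum_ind => [|b]; [elim/esum_ind => p; [|case: (El_zero p)]|];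
  rewrite /eassoc /elunit /erunit !eE.
Qed.

Lemma csp_hexagon A B C :
  class_cmp (class_cmp (fwd (csp_assoc B C A)) (fwd (csp_braid A (eplus B C))))
            (fwd (csp_assoc A B C)) =
  class_cmp (class_cmp (class_sum (class_graph id) (fwd (csp_braid A C)))
                       (fwd (csp_assoc B A C)))
            (class_sum (fwd (csp_braid A B)) (class_graph id)).
Proof.
rewrite /= !graph_sum !graph_cmp; apply: graph_eq.
by elim/esum_ind => [|d]; [elim/esum_ind => p|];
  rewrite /eassoc /eswap !eE.
Qed.

Lemma csp_braidK A B :
  class_cmp (fwd (csp_braid B A)) (fwd (csp_braid A B)) = class_graph id.
Proof. exact: (fwdK (csp_braid A B)). Qed.

Definition csp_smcat : smcat :=
  @SMCat csp_category ezero (@eplus U) class_sum class_sum1 class_sumM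
    csp_assoc csp_lunit csp_runit csp_braid
    csp_assoc_nat csp_lunit_nat csp_runit_nat csp_braid_nat
    csp_pentagon csp_triangle csp_hexagon csp_braidK.

Definition class_connected A B (P : cospan_class A B) : Prop :=
  exists x, P x /\ #|El (apex x)| = 1.

Definition class_reduced A B (P : cospan_class A B) : Prop :=
  exists x, P x /\
    forall p, (exists a, lleg x a = p) \/ (exists b, rleg x b = p).

End Cospans.

Definition Csp : smcat := csp_smcat finset_universe.
Definition Cstar : smcat := csp_smcat ordinal_universe.

Lemma ordinal_graph_identity (m n : ordinal_universe) (f : El m -> El n) :
  m = n -> (forall i : El m, val (f i : 'I_n) = val (i : 'I_m)) ->
  @is_identity (csp_category ordinal_universe) m n (class_graph f).
Proof.
move=> e; case: _ / e f => f fE.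
by rewrite (graph_eq (g := id)) // => i; apply/val_inj/fE.
Qed.

Lemma Cstar_permutative : is_permutative Cstar.
Proof.
split=> [m n p|n|n]; apply: ordinal_graph_identity.
- by rewrite /= addnA.
- elim/esum_ind => [|i]; last by rewrite /eassoc eE /= addnA.
  by elim/esum_ind => i; rewrite /eassoc !eE.
- by [].
- by elim/esum_ind => [[]//|i]; rewrite /elunit eE.
- by rewrite /= addn0.
- by elim/esum_ind => [i|[]//]; rewrite /erunit eE.
Qed.

Section Inclusion.
Variable U : fin_universe.
Implicit Types A B C : U.

Definition incl_cospan A B (x : cospan A B) :
    @cospan finset_universe (El A) (El B) :=
  @Cospan finset_universe (El A) (El B) (El (apex x)) (@lleg _ _ _ x) (@rleg _ _ _ x).

Lemma incl_class_subproof A B (P : cospan_class A B) :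
  exists z, forall z',
    (exists x, P x /\ cospan_iso (incl_cospan x) z') <-> cospan_iso z z'.
Proof.
have [x ->] := class_ofP P; exists (incl_cospan x) => z'; split.
  by move=> [x' [xx']]; apply: cospan_iso_trans; apply: xx'.
by exists x; split=> //; apply: cospan_iso_refl.
Qed.

Definition incl_class A B (P : cospan_class A B) :
    @cospan_class finset_universe (El A) (El B) :=
  CospanClass (incl_class_subproof P).

Lemma incl_classE A B (x : cospan A B) :
  incl_class (class_of x) = class_of (incl_cospan x).
Proof. by apply: class_of_mem; exists x; split; apply: cospan_iso_refl. Qed.

Lemma incl_graph A B (f : El A -> El B) :
  incl_class (class_graph f) = @class_graph finset_universe (El A) (El B) f.
Proof. exact: incl_classE. Qed.

Lemma incl_cmp A B C (Q : cospan_class B C) (P : cospan_class A B) :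
  incl_class (class_cmp Q P) = class_cmp (incl_class Q) (incl_class P).
Proof.
have [x ->] := class_ofP P; have [y ->] := class_ofP Q.
have [z xyz] := composite_exists x y.
rewrite (class_cmpE xyz) !incl_classE; apply/esym/class_cmpE; exact: xyz.
Qed.

Lemma incl_class_inj A B : injective (@incl_class A B).
Proof.
move=> P Q; have [x ->] := class_ofP P; have [y ->] := class_ofP Q.
by rewrite !incl_classE => /class_of_eq xy; apply/class_of_eq.
Qed.

Lemma incl_class_surj A B (Q : @cospan_class finset_universe (El A) (El B)) :
  exists P : cospan_class A B, incl_class P = Q.
Proof.
have [x ->] := class_ofP Q.
have [u [f fb]] := El_full U (apex x).
exists (class_of (@Cospan U A B u (fun a => f (lleg x a)) (fun b => f (rleg x b)))).
by rewrite incl_classE; apply/class_of_eq/cospan_iso_sym; exists f.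
Qed.

Definition incl_functor : functor (csp_smcat U) Csp :=
  @Functor (csp_smcat U) Csp (@El U) incl_class
    (fun A => incl_graph id) (fun A B C Q P => incl_cmp Q P).

Definition incl_F2 A B : @iso Csp (El A + El B)%type (El (eplus A B)) :=
  @graph_iso finset_universe (El A + El B)%type (El (eplus A B))
    ein eout (@einK U A B) (@eoutK U A B).

Definition incl_zero (x : void) : El (ezero : U) := match x with end.
Definition incl_zero' (x : El (ezero : U)) : void :=
  match El_zero x with end.
Lemma incl_zeroK : cancel incl_zero incl_zero'. Proof. by case. Qed.
Lemma incl_zeroVK : cancel incl_zero' incl_zero.
Proof. by move=> x; case: (El_zero x). Qed.

Definition incl_F0 : @iso Csp void (El (ezero : U)) :=
  @graph_iso finset_universe void (El (ezero : U))
    incl_zero incl_zero' incl_zeroK incl_zeroVK.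

Lemma incl_F2_nat A A' B B' (P : cospan_class A A') (Q : cospan_class B B') :
  class_cmp (fwd (incl_F2 A' B'))
    (@class_sum finset_universe _ _ _ _ (incl_class P) (incl_class Q)) =
  class_cmp (incl_class (class_sum P Q)) (fwd (incl_F2 A B)).
Proof.
have [x ->] := class_ofP P; have [y ->] := class_ofP Q.
rewrite class_sumE !incl_classE class_sumE /=.
apply: (graph_nat
  (x := @cospan_sum finset_universe _ _ _ _ (incl_cospan x) (incl_cospan y))
  (x' := incl_cospan (cospan_sum x y))
  (h := ein) (@einK U _ _) (@eoutK U _ _)).
- by exists eout; [apply: einK|apply: eoutK].
- by case=> p; rewrite /= /emap /ecase /= einK.
- by case=> p; rewrite /= /emap /ecase /= einK.
Qed.

End Inclusion.

(* [incl ordinal_universe] is the canonical inclusion of C( * ) into Csp. *)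
Definition incl (U : fin_universe) : smfunctor (csp_smcat U) Csp.
Proof.
apply: (@SMFunctor (csp_smcat U) Csp (incl_functor U) (@incl_F2 U) (@incl_F0 U)).
- move=> A A' B B' P Q; exact: incl_F2_nat.
- move=> A B C /=; rewrite !incl_graph !graph_sum !graph_cmp; apply: graph_eq.
  by case=> [[a|b]|c];
    rewrite /emap /ecase /eassoc /= -?[ein (inl _)]/(einl _ _) -?[ein (inr _)]/(einr _ _) ?eE.
- move=> A /=; rewrite !incl_graph !graph_sum !graph_cmp; apply: graph_eq.
  by case=> [[]|a]; rewrite /elunit /= -?[ein (inr _)]/(einr _ _) ?eE.
- move=> A /=; rewrite !incl_graph !graph_sum !graph_cmp; apply: graph_eq.
  by case=> [a|[]]; rewrite /erunit /= -?[ein (inl _)]/(einl _ _) ?eE.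
- move=> A B /=; rewrite !incl_graph !graph_cmp; apply: graph_eq.
  by case=> p; rewrite /eswap /= -?[ein (inl _)]/(einl _ _) -?[ein (inr _)]/(einr _ _) ?eE.
Defined.

(* [M], with operation [op] and neutral element [e], is freely generated as an
   abelian monoid by its subset [S]. *)
Definition freely_generated (M : Type) (op : M -> M -> M) (e : M)
    (S : M -> Prop) : Prop :=
  forall (N : Type) (add : N -> N -> N) (zero : N),
    associative add -> commutative add -> left_id zero add ->
  forall phi : {x : M | S x} -> N,
  exists! h : M -> N,
    [/\ h e = zero, forall x y, h (op x y) = add (h x) (h y)
      & forall s, h (proj1_sig s) = phi s].

Section LabelledCospan.
Variables (U : fin_universe) (C : smcat) (pi : smfunctor C (csp_smcat U)).

Definition connected_ob (c : C) : Prop := #|El (pi c)| = 1.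
Definition connected_mor (c d : C) (f : Hom c d) : Prop :=
  class_connected (fmap pi f).
Definition reduced_mor (c d : C) (f : Hom c d) : Prop :=
  class_reduced (fmap pi f).

Record is_lcc : Prop := IsLCC {
  lcc_ob : forall c : C, exists s : seq C,
    [/\ size s = #|El (pi c)|, List.Forall connected_ob s
      & inhabited (iso c (tens_seq s))];
  lcc_free : freely_generated (@cmp C munit munit munit) (idm munit)
    (@connected_mor munit munit);
  (* bijectivity of hom^r(c,d) x hom(1,1) -> hom(c (x) 1, d (x) 1) ~ hom(c,d) *)
  lcc_reduced : forall (c d : C) (h : Hom c d),
    exists! fx : Hom c d * Hom (munit : C) munit,
      reduced_mor fx.1 /\ h ∘ runit c = runit d ∘ (fx.1 ⊠ fx.2);
  (* the square is a pullback; hom(pi(c (x) c'), pi(d (x) d')) is identified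
     with hom(pi c (x) pi c', pi d (x) pi d') through the structure maps *)
  lcc_pullback : forall (c d c' d' : C) (h : Hom (c ⊗ c') (d ⊗ d'))
    (u : Hom (pi c) (pi d)) (u' : Hom (pi c') (pi d')),
    reduced_mor h -> class_reduced u -> class_reduced u' ->
    fmap pi h ∘ smF2 pi c c' = smF2 pi d d' ∘ (u ⊠ u') ->
    exists! ff' : Hom c d * Hom c' d',
      [/\ reduced_mor ff'.1, reduced_mor ff'.2, ff'.1 ⊠ ff'.2 = h,
          fmap pi ff'.1 = u & fmap pi ff'.2 = u']
}.

End LabelledCospan.

Lemma cmpKA (C : category) (a b c d : C) (k : Hom c d) (g : Hom b c)
    (f : Hom a b) (h : Hom a c) : g ∘ f = h -> k ∘ g ∘ f = k ∘ h.
Proof. by move=> <-; rewrite cmpA. Qed.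

Lemma tensm_cmpl (C : smcat) (a a' a'' b : C) (g : Hom a' a'') (f : Hom a a') :
  (g ∘ f) ⊠ idm b = (g ⊠ idm b) ∘ (f ⊠ idm b).
Proof. by rewrite -tensmM cmp1m. Qed.

Lemma tensm_cmpr (C : smcat) (a b b' b'' : C) (g : Hom b' b'') (f : Hom b b') :
  idm a ⊠ (g ∘ f) = (idm a ⊠ g) ∘ (idm a ⊠ f).
Proof. by rewrite -tensmM cmp1m. Qed.

Lemma iso_cmp_subproof (C : category) (a b c : C) (g : iso b c) (f : iso a b) :
  (bwd f ∘ bwd g) ∘ (g ∘ f) = idm a.
Proof. by rewrite -cmpA (cmpA (bwd g)) fwdK cmp1m fwdK. Qed.

Lemma iso_cmp_subproof' (C : category) (a b c : C) (g : iso b c) (f : iso a b) :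
  (g ∘ f) ∘ (bwd f ∘ bwd g) = idm c.
Proof. by rewrite -cmpA (cmpA f) bwdK cmp1m bwdK. Qed.

Definition iso_cmp (C : category) (a b c : C) (g : iso b c) (f : iso a b) :
  iso a c := Iso (iso_cmp_subproof g f) (iso_cmp_subproof' g f).

Lemma iso_fmap_subproof (C D : category) (F : functor C D) (a b : C) (f : iso a b) :
  fmap F (bwd f) ∘ fmap F f = idm (F a).
Proof. by rewrite -fmapM fwdK fmap1. Qed.

Lemma iso_fmap_subproof' (C D : category) (F : functor C D) (a b : C) (f : iso a b) :
  fmap F f ∘ fmap F (bwd f) = idm (F b).
Proof. by rewrite -fmapM bwdK fmap1. Qed.

Definition iso_fmap (C D : category) (F : functor C D) (a b : C) (f : iso a b) :
  iso (F a) (F b) := Iso (iso_fmap_subproof F f) (iso_fmap_subproof' F f).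

Definition iso_id (C : category) (a : C) : iso a a :=
  Iso (cmp1m (idm a)) (cmp1m (idm a)).

Definition smfunctor_id (C : smcat) : smfunctor C C.
Proof.
apply: (@SMFunctor C C (functor_id C)
  (fun a b => iso_id (a ⊗ b)) (iso_id munit)).
- by move=> *; rewrite /= cmp1m cmpm1.
- by move=> a b c; rewrite /= !tensm1 !cmp1m !cmpm1.
- by move=> a; rewrite /= tensm1 !cmpm1.
- by move=> a; rewrite /= tensm1 !cmpm1.
- by move=> a b; rewrite /= cmp1m cmpm1.
Defined.

Definition smfunctor_comp (C D E : smcat) (G : smfunctor D E)
    (F : smfunctor C D) : smfunctor C E.
Proof.
apply: (@SMFunctor C E (functor_comp G F)
  (fun a b => iso_cmp (iso_fmap G (smF2 F a b)) (smF2 G (F a) (F b)))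
  (iso_cmp (iso_fmap G (smF0 F)) (smF0 G))).
- move=> a a' b b' f g /=.
  by rewrite -cmpA smF2_nat !cmpA -!fmapM smF2_nat.
- move=> a b c /=.
  rewrite tensm_cmpl tensm_cmpr !cmpA.
  rewrite -(fmap1 G (F c)) -(fmap1 G (F a)).
  rewrite -(cmpA _ (smF2 G (F (a ⊗ b)) (F c))) smF2_nat.
  rewrite -(cmpA _ (smF2 G (F a) (F (b ⊗ c)))) smF2_nat !cmpA -!fmapM.
  rewrite smF2_assoc (fmapM G _ (assoc _ _ _)) !fmap1.
  by rewrite -!cmpA; congr (_ ∘ _); rewrite !cmpA smF2_assoc.
- move=> a /=.
  rewrite tensm_cmpl !cmpA -(fmap1 G (F a)).
  rewrite -(cmpA _ (smF2 G (F munit) (F a))) smF2_nat !cmpA -!fmapM.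
  by rewrite smF2_lunit fmap1 smF2_lunit.
- move=> a /=.
  rewrite tensm_cmpr !cmpA -(fmap1 G (F a)).
  rewrite -(cmpA _ (smF2 G (F a) (F munit))) smF2_nat !cmpA -!fmapM.
  by rewrite smF2_runit fmap1 smF2_runit.
- move=> a b /=.
  by rewrite cmpA -fmapM smF2_braid fmapM -!cmpA smF2_braid.
Defined.

Lemma smfunctor_compA (C D E E' : smcat) (H : smfunctor E E')
    (G : smfunctor D E) (F : smfunctor C D) :
  smfunctor_comp H (smfunctor_comp G F) = smfunctor_comp (smfunctor_comp H G) F.
Proof.
apply: smfunctor_eq => [|a b|] /=.
- exact: functor_eq.
- by apply: eq_hom_eq; rewrite fmapM cmpA.
- by apply: eq_hom_eq; rewrite fmapM cmpA.
Qed.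

Lemma smfunctor_comp1m (C D : smcat) (F : smfunctor C D) :
  smfunctor_comp (smfunctor_id D) F = F.
Proof.
by apply: smfunctor_eq => [|a b|] /=; [exact: functor_eq|..];
  apply: eq_hom_eq; rewrite cmpm1.
Qed.

Lemma smfunctor_compm1 (C D : smcat) (F : smfunctor C D) :
  smfunctor_comp F (smfunctor_id C) = F.
Proof.
by apply: smfunctor_eq => [|a b|] /=; [exact: functor_eq|..];
  apply: eq_hom_eq; rewrite fmap1 cmp1m.
Qed.

Lemma is_strict_id (C : smcat) : is_strict (smfunctor_id C).
Proof. by []. Qed.

Lemma is_strict_comp (C D E : smcat) (G : smfunctor D E) (F : smfunctor C D) :
  is_strict G -> is_strict F -> is_strict (smfunctor_comp G F).
Proof.
move=> [G2 G0] [F2 F0]; split=> [a b|]; apply: is_identity_cmp => //=;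
  exact: (@is_identity_fmap _ _ G).
Qed.

Definition mnat_id (C D : smcat) (F : smfunctor C D) : mnat F F.
Proof.
apply: (@MNat C D F F (@NatTrans C D F F (fun a => idm (F a)) _)).
- by move=> a b f; rewrite cmp1m cmpm1.
- by move=> p a b; rewrite /= tensm1 cmp1m cmpm1.
- by move=> p; rewrite /= cmp1m.
Defined.

Definition mnat_cmp (C D : smcat) (F G H : smfunctor C D)
    (t : mnat G H) (s : mnat F G) : mnat F H.
Proof.
apply: (@MNat C D F H (@NatTrans C D F H (fun a => t a ∘ s a) _)).
- by move=> a b f; rewrite -cmpA tr_nat !cmpA tr_nat.
- by move=> p a b; rewrite /= -cmpA mtr_tens cmpA mtr_tens -cmpA -tensmM.
- by move=> p; rewrite /= -cmpA !mtr_unit.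
Defined.

Definition mnat_whiskl (C D E : smcat) (H : smfunctor D E) (F G : smfunctor C D)
    (s : mnat F G) : mnat (smfunctor_comp H F) (smfunctor_comp H G).
Proof.
apply: (@MNat C E (smfunctor_comp H F) (smfunctor_comp H G)
  (@NatTrans C E (smfunctor_comp H F) (smfunctor_comp H G)
     (fun a => fmap H (s a)) _)).
- by move=> a b f; rewrite /= -!fmapM tr_nat.
- move=> p a b; rewrite /= cmpA -fmapM mtr_tens fmapM -!cmpA.
  by rewrite smF2_nat.
- by move=> p; rewrite /= cmpA -fmapM mtr_unit.
Defined.

Definition mnat_whiskr (C D E : smcat) (G H : smfunctor D E) (s : mnat G H)
    (F : smfunctor C D) : mnat (smfunctor_comp G F) (smfunctor_comp H F).
Proof.
apply: (@MNat C E (smfunctor_comp G F) (smfunctor_comp H F)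
  (@NatTrans C E (smfunctor_comp G F) (smfunctor_comp H F)
     (fun a => s (F a)) _)).
- by move=> a b f; rewrite /= tr_nat.
- by move=> p a b; rewrite /= cmpA tr_nat -!cmpA mtr_tens.
- by move=> p; rewrite /= cmpA tr_nat -!cmpA mtr_unit.
Defined.

Definition mnat_hcmp (C D E : smcat) (G G' : smfunctor D E)
    (F F' : smfunctor C D) (t : mnat G G') (s : mnat F F') :
    mnat (smfunctor_comp G F) (smfunctor_comp G' F') :=
  mnat_cmp (mnat_whiskr t F') (mnat_whiskl G s).

Definition mnat_of_eq (C D : smcat) (F G : smfunctor C D) (e : F = G) : mnat F G :=
  match e with erefl => mnat_id F end.

Lemma mnat_of_eq_identity (C D : smcat) (F G : smfunctor C D) (e : F = G) c :
  is_identity (mnat_of_eq e c).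
Proof. by case: _ / e. Qed.

Record lcc := LCC_ob {
  lcc_car : smcat;
  lcc_pi : smfunctor lcc_car Csp;
  lcc_axioms : @is_lcc finset_universe lcc_car lcc_pi
}.

Record lcc1 (X Y : lcc) := LCC1 {
  l1_fun : smfunctor (lcc_car X) (lcc_car Y);
  l1_nat : mnat (smfunctor_comp (lcc_pi Y) l1_fun) (lcc_pi X);
  l1_iso : forall c, is_iso (l1_nat c)
}.

Record lcc2 (X Y : lcc) (f g : lcc1 X Y) := LCC2 {
  l2_nat : mnat (l1_fun f) (l1_fun g);
  l2_iso : forall c, is_iso (mnat_cmp (l1_nat g) (mnat_whiskl (lcc_pi Y) l2_nat) c)
}.

Lemma lcc1_eq (X Y : lcc) (f g : lcc1 X Y) :
  l1_fun f = l1_fun g -> (forall c, hom_eq (l1_nat f c) (l1_nat g c)) -> f = g.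
Proof.
case: f g => [f a fa] [g b gb] /= e; case: _ / e in b gb * => ab.
have e : a = b by apply: mnat_eq => c; apply/hom_eqE/ab.
by case: _ / e in gb {ab} *; rewrite (Prop_irrelevance fa gb).
Qed.

Lemma lcc2_eq (X Y : lcc) (f g : lcc1 X Y) (s t : lcc2 f g) :
  (forall c, l2_nat s c = l2_nat t c) -> s = t.
Proof.
case: s t => [s ss] [t tt] /= /mnat_eq e.
by case: _ / e in tt *; rewrite (Prop_irrelevance ss tt).
Qed.

Lemma l2_piE (X Y : lcc) (f g : lcc1 X Y) (s : lcc2 f g) c :
  is_iso (fmap (lcc_pi Y) (l2_nat s c)).
Proof. exact: is_iso_cancell (l1_iso g c) (l2_iso s c). Qed.

Lemma lcc2_intro (X Y : lcc) (f g : lcc1 X Y) (s : mnat (l1_fun f) (l1_fun g)) :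
  (forall c, is_iso (fmap (lcc_pi Y) (s c))) ->
  forall c, is_iso (mnat_cmp (l1_nat g) (mnat_whiskl (lcc_pi Y) s) c).
Proof. by move=> h c; apply: is_iso_cmp (l1_iso g c) (h c). Qed.

Lemma lcc2_id_subproof (X Y : lcc) (f : lcc1 X Y) c :
  is_iso (fmap (lcc_pi Y) (mnat_id (l1_fun f) c)).
Proof. exact/is_iso_fmap/is_iso_id. Qed.

Lemma lcc2_cmp_subproof (X Y : lcc) (f g h : lcc1 X Y) (t : lcc2 g h)
    (s : lcc2 f g) c :
  is_iso (fmap (lcc_pi Y) (mnat_cmp (l2_nat t) (l2_nat s) c)).
Proof. by rewrite /= fmapM; apply: is_iso_cmp; apply: l2_piE. Qed.

Definition lcc2_id (X Y : lcc) (f : lcc1 X Y) : lcc2 f f :=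
  LCC2 (lcc2_intro (@lcc2_id_subproof X Y f)).

Definition lcc2_cmp (X Y : lcc) (f g h : lcc1 X Y) (t : lcc2 g h)
    (s : lcc2 f g) : lcc2 f h :=
  LCC2 (lcc2_intro (lcc2_cmp_subproof t s)).

Definition lcc_hom (X Y : lcc) : category.
Proof.
apply: (@Category (lcc1 X Y) (@lcc2 X Y) (@lcc2_id X Y) (@lcc2_cmp X Y)).
- by move=> *; apply: lcc2_eq => c /=; rewrite cmpA.
- by move=> *; apply: lcc2_eq => c /=; rewrite cmp1m.
- by move=> *; apply: lcc2_eq => c /=; rewrite cmpm1.
Defined.

Lemma lcc2_hom_eq (X Y : lcc) (f g f' g' : lcc_hom X Y)
    (s : Hom f g) (s' : Hom f' g') : f = f' -> g = g' ->
  (forall c, hom_eq (l2_nat s c) (l2_nat s' c)) -> hom_eq s s'.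
Proof.
move=> ef eg; case: _ / ef in s' *; case: _ / eg in s' * => e.
by apply/eq_hom_eq/lcc2_eq => c; apply/hom_eqE.
Qed.

Lemma lcc1_id_subproof (X : lcc) c :
  is_iso (mnat_of_eq (smfunctor_compm1 (lcc_pi X)) c).
Proof. exact/is_identity_iso/mnat_of_eq_identity. Qed.

Definition lcc1_id (X : lcc) : lcc1 X X := LCC1 (@lcc1_id_subproof X).

Lemma lcc1_id_natE (X : lcc) c : l1_nat (lcc1_id X) c = idm (lcc_pi X c).
Proof.
exact: esym (hom_eqE (mnat_of_eq_identity (smfunctor_compm1 (lcc_pi X)) c)).
Qed.

Definition lcc1_cmp_nat (X Y Z : lcc) (g : lcc1 Y Z) (f : lcc1 X Y) :
    mnat (smfunctor_comp (lcc_pi Z) (smfunctor_comp (l1_fun g) (l1_fun f)))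
         (lcc_pi X) :=
  mnat_cmp (l1_nat f)
    (mnat_cmp (mnat_whiskr (l1_nat g) (l1_fun f))
       (mnat_of_eq (smfunctor_compA (lcc_pi Z) (l1_fun g) (l1_fun f)))).

Lemma lcc1_cmp_natE (X Y Z : lcc) (g : lcc1 Y Z) (f : lcc1 X Y) c :
  lcc1_cmp_nat g f c = l1_nat f c ∘ l1_nat g (l1_fun f c).
Proof.
rewrite -[l1_nat g _]cmpm1 (hom_eqE (mnat_of_eq_identity
  (smfunctor_compA (lcc_pi Z) (l1_fun g) (l1_fun f)) c)).
by [].
Qed.

Lemma lcc1_cmp_subproof (X Y Z : lcc) (g : lcc1 Y Z) (f : lcc1 X Y) c :
  is_iso (lcc1_cmp_nat g f c).
Proof. by rewrite lcc1_cmp_natE; apply: is_iso_cmp; apply: l1_iso. Qed.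

Definition lcc1_cmp (X Y Z : lcc) (g : lcc1 Y Z) (f : lcc1 X Y) : lcc1 X Z :=
  LCC1 (lcc1_cmp_subproof g f).

Lemma lcc1_natE (X Y Z : lcc) (g : lcc1 Y Z) (f : lcc1 X Y) c :
  l1_nat (lcc1_cmp g f) c = l1_nat f c ∘ l1_nat g (l1_fun f c).
Proof. exact: lcc1_cmp_natE. Qed.

Lemma lcc2_hcmp_subproof (X Y Z : lcc) (g g' : lcc1 Y Z) (f f' : lcc1 X Y)
    (t : lcc2 g g') (s : lcc2 f f') c :
  is_iso (fmap (lcc_pi Z) (mnat_hcmp (l2_nat t) (l2_nat s) c)).
Proof.
rewrite /= fmapM; apply: is_iso_cmp; first exact: l2_piE.
apply: (is_iso_cancell (l1_iso g _)).
have /= -> := tr_nat (l1_nat g) (l2_nat s c).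
by apply: is_iso_cmp; [exact: l2_piE|exact: l1_iso].
Qed.

Definition lcc2_hcmp (X Y Z : lcc) (g g' : lcc1 Y Z) (f f' : lcc1 X Y)
    (t : lcc2 g g') (s : lcc2 f f') : lcc2 (lcc1_cmp g f) (lcc1_cmp g' f') :=
  @LCC2 X Z (lcc1_cmp g f) (lcc1_cmp g' f') _
    (@lcc2_intro X Z (lcc1_cmp g f) (lcc1_cmp g' f') _
       (lcc2_hcmp_subproof t s)).

Lemma lcc1_cmpA (X Y Z W : lcc) (h : lcc1 Z W) (g : lcc1 Y Z) (f : lcc1 X Y) :
  lcc1_cmp h (lcc1_cmp g f) = lcc1_cmp (lcc1_cmp h g) f.
Proof.
apply: lcc1_eq => [|c]; first exact: smfunctor_compA.
by apply: eq_hom_eq; rewrite !lcc1_natE cmpA.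
Qed.

Lemma lcc1_cmp1m (X Y : lcc) (f : lcc1 X Y) : lcc1_cmp (lcc1_id Y) f = f.
Proof.
apply: lcc1_eq => [|c]; first exact: smfunctor_comp1m.
apply: eq_hom_eq; rewrite lcc1_natE.
by rewrite lcc1_id_natE cmpm1.
Qed.

Lemma lcc1_cmpm1 (X Y : lcc) (f : lcc1 X Y) : lcc1_cmp f (lcc1_id X) = f.
Proof.
apply: lcc1_eq => [|c]; first exact: smfunctor_compm1.
apply: eq_hom_eq; rewrite lcc1_natE.
by rewrite lcc1_id_natE cmp1m.
Qed.

Definition LCC : two_category.
Proof.
apply: (@TwoCategory lcc lcc_hom lcc1_id lcc1_cmp lcc2_hcmp).
- by move=> X Y Z g f; apply: lcc2_eq => c /=; rewrite fmap1 cmpm1.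
- move=> X Y Z g g' g'' f f' f'' t t' s s'; apply: lcc2_eq => c /=.
  rewrite fmapM -!cmpA; congr (_ ∘ _); rewrite !cmpA; congr (_ ∘ _).
  by rewrite tr_nat.
- exact: lcc1_cmpA.
- exact: lcc1_cmp1m.
- exact: lcc1_cmpm1.
- move=> X Y Z W h h' g g' f f' u t s.
  apply: lcc2_hom_eq; try exact: lcc1_cmpA.
  by move=> c; apply: eq_hom_eq => /=; rewrite fmapM cmpA.
- move=> X Y f f' s; apply: lcc2_hom_eq; try exact: lcc1_cmp1m.
  by move=> c; apply: eq_hom_eq => /=; rewrite cmp1m.
- move=> X Y f f' s; apply: lcc2_hom_eq; try exact: lcc1_cmpm1.
  by move=> c; apply: eq_hom_eq => /=; rewrite fmap1 cmpm1.
Defined.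

Record slcc := SLCC_ob {
  slcc_car : smcat;
  slcc_perm : is_permutative slcc_car;
  slcc_pi : smfunctor slcc_car Cstar;
  slcc_strict : is_strict slcc_pi;
  slcc_axioms : @is_lcc ordinal_universe slcc_car slcc_pi;
  slcc_uniq : forall c : slcc_car, exists! s : seq slcc_car,
    [/\ size s = slcc_pi c, List.Forall (@connected_ob ordinal_universe _ slcc_pi) s
      & c = tens_seq s]
}.

Record slcc1 (X Y : slcc) := SLCC1 {
  s1_fun : smfunctor (slcc_car X) (slcc_car Y);
  s1_strict : is_strict s1_fun;
  s1_over : smfunctor_comp (slcc_pi Y) s1_fun = slcc_pi X
}.

Record slcc2 (X Y : slcc) (f g : slcc1 X Y) := SLCC2 {
  s2_nat : mnat (s1_fun f) (s1_fun g);
  s2_over : forall c, is_identity (mnat_whiskl (slcc_pi Y) s2_nat c)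
}.

Lemma slcc1_eq (X Y : slcc) (f g : slcc1 X Y) : s1_fun f = s1_fun g -> f = g.
Proof.
case: f g => [f sf of_] [g sg og] /= e; case: _ / e in sg og *.
by rewrite (Prop_irrelevance sf sg) (Prop_irrelevance of_ og).
Qed.

Lemma slcc2_eq (X Y : slcc) (f g : slcc1 X Y) (s t : slcc2 f g) :
  (forall c, s2_nat s c = s2_nat t c) -> s = t.
Proof.
case: s t => [s ss] [t tt] /= /mnat_eq e.
by case: _ / e in tt *; rewrite (Prop_irrelevance ss tt).
Qed.

Lemma slcc2_id_subproof (X Y : slcc) (f : slcc1 X Y) c :
  is_identity (mnat_whiskl (slcc_pi Y) (mnat_id (s1_fun f)) c).
Proof. exact: (@is_identity_fmap _ _ (slcc_pi Y)). Qed.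

Lemma slcc2_cmp_subproof (X Y : slcc) (f g h : slcc1 X Y) (t : slcc2 g h)
    (s : slcc2 f g) c :
  is_identity (mnat_whiskl (slcc_pi Y) (mnat_cmp (s2_nat t) (s2_nat s)) c).
Proof.
exact: (@is_identity_fmap_cmp _ _ (slcc_pi Y) _ _ _ _ _ (s2_over s c) (s2_over t c)).
Qed.

Definition slcc2_id (X Y : slcc) (f : slcc1 X Y) : slcc2 f f :=
  SLCC2 (@slcc2_id_subproof X Y f).

Definition slcc2_cmp (X Y : slcc) (f g h : slcc1 X Y) (t : slcc2 g h)
    (s : slcc2 f g) : slcc2 f h :=
  SLCC2 (slcc2_cmp_subproof t s).

Definition slcc_hom (X Y : slcc) : category.
Proof.
apply: (@Category (slcc1 X Y) (@slcc2 X Y) (@slcc2_id X Y) (@slcc2_cmp X Y)).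
- by move=> *; apply: slcc2_eq => c /=; rewrite cmpA.
- by move=> *; apply: slcc2_eq => c /=; rewrite cmp1m.
- by move=> *; apply: slcc2_eq => c /=; rewrite cmpm1.
Defined.

Lemma slcc2_hom_eq (X Y : slcc) (f g f' g' : slcc_hom X Y)
    (s : Hom f g) (s' : Hom f' g') : f = f' -> g = g' ->
  (forall c, hom_eq (s2_nat s c) (s2_nat s' c)) -> hom_eq s s'.
Proof.
move=> ef eg; case: _ / ef in s' *; case: _ / eg in s' * => e.
by apply/eq_hom_eq/slcc2_eq => c; apply/hom_eqE.
Qed.

Definition slcc1_id (X : slcc) : slcc1 X X :=
  SLCC1 (is_strict_id (slcc_car X)) (smfunctor_compm1 (slcc_pi X)).

Lemma slcc1_cmp_subproof (X Y Z : slcc) (g : slcc1 Y Z) (f : slcc1 X Y) :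
  smfunctor_comp (slcc_pi Z) (smfunctor_comp (s1_fun g) (s1_fun f)) = slcc_pi X.
Proof. by rewrite smfunctor_compA !s1_over. Qed.

Definition slcc1_cmp (X Y Z : slcc) (g : slcc1 Y Z) (f : slcc1 X Y) : slcc1 X Z :=
  SLCC1 (is_strict_comp (s1_strict g) (s1_strict f)) (slcc1_cmp_subproof g f).

Lemma slcc2_hcmp_subproof (X Y Z : slcc) (g g' : slcc1 Y Z) (f f' : slcc1 X Y)
    (t : slcc2 g g') (s : slcc2 f f') c :
  is_identity (mnat_whiskl (slcc_pi Z) (mnat_hcmp (s2_nat t) (s2_nat s)) c).
Proof.
have h : is_identity (fmap (slcc_pi Z) (fmap (s1_fun g) (s2_nat s c))).
  change (is_identity (fmap (smfunctor_comp (slcc_pi Z) (s1_fun g)) (s2_nat s c))).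
  by rewrite s1_over; exact: (s2_over s).
exact: (@is_identity_fmap_cmp _ _ (slcc_pi Z) _ _ _ _ _ h (s2_over t _)).
Qed.

Definition slcc2_hcmp (X Y Z : slcc) (g g' : slcc1 Y Z) (f f' : slcc1 X Y)
    (t : slcc2 g g') (s : slcc2 f f') : slcc2 (slcc1_cmp g f) (slcc1_cmp g' f') :=
  @SLCC2 X Z (slcc1_cmp g f) (slcc1_cmp g' f') _ (slcc2_hcmp_subproof t s).

Lemma slcc1_cmpA (X Y Z W : slcc) (h : slcc1 Z W) (g : slcc1 Y Z) (f : slcc1 X Y) :
  slcc1_cmp h (slcc1_cmp g f) = slcc1_cmp (slcc1_cmp h g) f.
Proof. exact/slcc1_eq/smfunctor_compA. Qed.

Lemma slcc1_cmp1m (X Y : slcc) (f : slcc1 X Y) : slcc1_cmp (slcc1_id Y) f = f.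
Proof. exact/slcc1_eq/smfunctor_comp1m. Qed.

Lemma slcc1_cmpm1 (X Y : slcc) (f : slcc1 X Y) : slcc1_cmp f (slcc1_id X) = f.
Proof. exact/slcc1_eq/smfunctor_compm1. Qed.

Definition SLCC : two_category.
Proof.
apply: (@TwoCategory slcc slcc_hom slcc1_id slcc1_cmp slcc2_hcmp).
- by move=> X Y Z g f; apply: slcc2_eq => c /=; rewrite fmap1 cmpm1.
- move=> X Y Z g g' g'' f f' f'' t t' s s'; apply: slcc2_eq => c /=.
  rewrite fmapM -!cmpA; congr (_ ∘ _); rewrite !cmpA; congr (_ ∘ _).
  by rewrite tr_nat.
- exact: slcc1_cmpA.
- exact: slcc1_cmp1m.
- exact: slcc1_cmpm1.
- move=> X Y Z W h h' g g' f f' u t s.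
  apply: slcc2_hom_eq; try exact: slcc1_cmpA.
  by move=> c; apply: eq_hom_eq => /=; rewrite fmapM cmpA.
- move=> X Y f f' s; apply: slcc2_hom_eq; try exact: slcc1_cmp1m.
  by move=> c; apply: eq_hom_eq => /=; rewrite cmp1m.
- move=> X Y f f' s; apply: slcc2_hom_eq; try exact: slcc1_cmpm1.
  by move=> c; apply: eq_hom_eq => /=; rewrite fmap1 cmpm1.
Defined.

Lemma incl_connected (U : fin_universe) (A B : U) (P : cospan_class A B) :
  class_connected (incl_class P) <-> class_connected P.
Proof.
have [x ->] := class_ofP P; rewrite incl_classE; split=> -[y [xy y1]].
  exists x; split; first exact: cospan_iso_refl.
  by case: xy => h [/bij_eq_card <- _ _] in y1 *.
exists (incl_cospan x); split; first exact: cospan_iso_refl.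
by case: xy => h [/bij_eq_card e _ _]; rewrite /= e.
Qed.

Lemma incl_reduced (U : fin_universe) (A B : U) (P : cospan_class A B) :
  class_reduced (incl_class P) <-> class_reduced P.
Proof.
have [x ->] := class_ofP P; rewrite incl_classE; split=> -[y [xy yr]].
  exists x; split=> [|p]; first exact: cospan_iso_refl.
  case: xy => h [[h' hK _] hl hr].
  by case: (yr (h p)) => [[a e]|[b e]]; [left; exists a|right; exists b];
    apply: (can_inj hK); rewrite -e ?hl ?hr.
exists (incl_cospan x); split=> [|p]; first exact: cospan_iso_refl.
case: xy => h [[h' hK _] hl hr].
by case: (yr (h p)) => [[a e]|[b e]]; [left; exists a|right; exists b];
  apply: (can_inj hK); rewrite -e ?hl ?hr.
Qed.

Section Transfer.
Variables (U : fin_universe) (C : smcat) (pi : smfunctor C (csp_smcat U)).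
Let pit : smfunctor C Csp := smfunctor_comp (incl U) pi.

Lemma incl_connected_mor (c d : C) :
  @connected_mor finset_universe C pit c d = @connected_mor U C pi c d.
Proof.
by apply: functional_extensionality_dep => f; apply/propext/incl_connected.
Qed.

Lemma incl_reduced_mor (c d : C) (f : Hom c d) :
  @reduced_mor finset_universe C pit c d f = @reduced_mor U C pi c d f.
Proof. exact/propext/incl_reduced. Qed.

Lemma incl_lcc : @is_lcc U C pi -> @is_lcc finset_universe C pit.
Proof.
case=> ob fr re pb; split.
- exact: ob.
- by rewrite incl_connected_mor.
- move=> c d h; have [fx [[r e] un]] := re c d h.
  exists fx; split; first by rewrite incl_reduced_mor.
  by move=> gy; rewrite incl_reduced_mor; apply: un.
- move=> c d c' d' h v v'; rewrite incl_reduced_mor => hr.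
  have [u <-] := incl_class_surj (v : @cospan_class finset_universe (El _) (El _)).
  have [u' <-] := incl_class_surj (v' : @cospan_class finset_universe (El _) (El _)).
  move=> /incl_reduced ur /incl_reduced ur' e.
  pose I : smfunctor (csp_smcat U) Csp := incl U.
  have e1 : fmap I (fmap pi h) ∘ (fmap I (smF2 pi c c') ∘ smF2 I (pi c) (pi c')) =
      fmap I (smF2 pi d d') ∘ smF2 I (pi d) (pi d') ∘
      @tensm Csp _ _ _ _ (@fmap (csp_smcat U) Csp I _ _ u)
        (@fmap (csp_smcat U) Csp I _ _ u').
    exact: e.
  have e' : fmap pi h ∘ smF2 pi c c' = smF2 pi d d' ∘ @tensm (csp_smcat U) _ _ _ _ u u'.
    apply: (@incl_class_inj U).
    have e2 : fmap I (fmap pi h ∘ smF2 pi c c') ∘ smF2 I (pi c) (pi c') =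
        fmap I (smF2 pi d d' ∘ @tensm (csp_smcat U) _ _ _ _ u u') ∘
        smF2 I (pi c) (pi c').
      by rewrite !fmapM -!cmpA -smF2_nat e1 cmpA.
    move/(congr1 (fun k => k ∘ bwd (smF2 I (pi c) (pi c')))): e2.
    by rewrite -!cmpA bwdK !cmpm1.
  have [ff' [[r1 r2 e0 e2 e3] un]] := pb _ _ _ _ h u u' hr ur ur' e'.
  exists ff'; split.
    split; rewrite ?incl_reduced_mor //=; by rewrite ?e2 ?e3.
  move=> gg'; rewrite !incl_reduced_mor => -[s1 s2 g0 g1 g2].
  apply: un; split=> //; exact: (@incl_class_inj U).
Qed.

End Transfer.

Definition slcc_to_lcc_ob (X : slcc) : lcc :=
  @LCC_ob (slcc_car X) (smfunctor_comp (incl ordinal_universe) (slcc_pi X))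
    (incl_lcc (slcc_axioms X)).

Lemma slcc_to_lcc_over (X Y : slcc) (f : slcc1 X Y) :
  smfunctor_comp (smfunctor_comp (incl ordinal_universe) (slcc_pi Y)) (s1_fun f) =
  smfunctor_comp (incl ordinal_universe) (slcc_pi X).
Proof. by rewrite -smfunctor_compA s1_over. Qed.

Lemma slcc_to_lcc1_subproof (X Y : slcc) (f : slcc1 X Y) c :
  is_iso (mnat_of_eq (slcc_to_lcc_over f) c).
Proof. exact/is_identity_iso/mnat_of_eq_identity. Qed.

Definition slcc_to_lcc1 (X Y : slcc) (f : slcc1 X Y) :
    lcc1 (slcc_to_lcc_ob X) (slcc_to_lcc_ob Y) :=
  @LCC1 (slcc_to_lcc_ob X) (slcc_to_lcc_ob Y) (s1_fun f)
    (mnat_of_eq (slcc_to_lcc_over f)) (slcc_to_lcc1_subproof f).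

Lemma slcc_to_lcc2_subproof (X Y : slcc) (f g : slcc1 X Y) (s : slcc2 f g) c :
  is_iso (fmap (smfunctor_comp (incl ordinal_universe) (slcc_pi Y)) (s2_nat s c)).
Proof.
apply: is_identity_iso.
exact: (@is_identity_fmap _ _ (incl ordinal_universe) _ _ _ (s2_over s c)).
Qed.

Definition slcc_to_lcc2 (X Y : slcc) (f g : slcc1 X Y) (s : slcc2 f g) :
    lcc2 (slcc_to_lcc1 f) (slcc_to_lcc1 g) :=
  @LCC2 _ _ (slcc_to_lcc1 f) (slcc_to_lcc1 g) (s2_nat s)
    (@lcc2_intro _ _ (slcc_to_lcc1 f) (slcc_to_lcc1 g) (s2_nat s)
       (slcc_to_lcc2_subproof s)).

Definition slcc_to_lcc_hom (X Y : slcc) :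
    functor (slcc_hom X Y) (lcc_hom (slcc_to_lcc_ob X) (slcc_to_lcc_ob Y)).
Proof.
apply: (@Functor (slcc_hom X Y) (lcc_hom _ _) (@slcc_to_lcc1 X Y)
  (@slcc_to_lcc2 X Y)).
- by move=> f; apply: lcc2_eq.
- by move=> f g h t s; apply: lcc2_eq.
Defined.

Lemma slcc_to_lcc1_id (X : slcc) :
  slcc_to_lcc1 (slcc1_id X) = lcc1_id (slcc_to_lcc_ob X).
Proof.
apply: lcc1_eq => // c; apply: is_identity_hom_eq => //;
  exact: mnat_of_eq_identity.
Qed.

Lemma slcc_to_lcc1_cmp (X Y Z : slcc) (g : slcc1 Y Z) (f : slcc1 X Y) :
  slcc_to_lcc1 (slcc1_cmp g f) = lcc1_cmp (slcc_to_lcc1 g) (slcc_to_lcc1 f).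
Proof.
apply: lcc1_eq => // c; apply: is_identity_hom_eq => //.
  exact: mnat_of_eq_identity.
rewrite lcc1_natE; apply: is_identity_cmp.
  exact: (mnat_of_eq_identity (slcc_to_lcc_over g) (s1_fun f c)).
exact: (mnat_of_eq_identity (slcc_to_lcc_over f) c).
Qed.

Definition slcc_to_lcc : two_functor SLCC LCC.
Proof.
apply: (@TwoFunctor SLCC LCC slcc_to_lcc_ob slcc_to_lcc_hom).
- exact: slcc_to_lcc1_id.
- by move=> X Y Z g f; exact: slcc_to_lcc1_cmp.
- move=> X Y Z g g' f f' d c.
  by apply: lcc2_hom_eq => [||x]; try exact: slcc_to_lcc1_cmp.
Defined.

(* Main.v *)
Require Import Defs.
From mathcomp Require Import all_boot.
From mathcomp Require Import boolp.
Set Implicit Arguments.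
Unset Strict Implicit.
Unset Printing Implicit Defensive.

(** Both halves of the biequivalence rest on one construction and one rigidity
   fact.

   The construction ([strict_lift_ex]) makes functors strict. Suppose that every
   object of a permutative category [D] is, compatibly with the tensor product,
   given by a word of generators. A symmetric monoidal functor [Q] out of [D]
   is then isomorphic to the one sending the word x1 ... xn to
   Q x1 ⊗ ... ⊗ Q xn, and this one is strict as soon as its target is
   permutative. More generally, the target of [Q] may be a category [B] in which a
   permutative category [A] sits by a fully faithful functor: if the [Q xi] are
   isomorphic to objects of [A], the strict functor lands in [A].

   The rigidity fact ([strict_nat_identity]) is that a monoidal natural isomorphism
   between strict functors to C( * ) is an identity at every tensor product of
   connected objects: it is determined by its components at the factors, and
   those are invertible cospans between one-point sets. When all objects are such
   products, isomorphic strict functors to C( * ) are therefore equal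
   ([strict_nat_eq]), and a 2-morphism which is invertible over Csp lies over
   the identity.

   On hom-categories, rigidity says that the 2-functor is full on 2-morphisms, while
   faithfulness is clear. A 1-morphism (F, α) between strict labelled cospan
   categories is isomorphic to a strict functor by the construction, since
   by [slcc_uniq] every object is uniquely a word of connected objects; by
   rigidity this strict functor commutes with the projections on the nose.

   On objects, a labelled cospan category [C] is replaced by the category whose
   objects are the words of connected objects of [C], a morphism between two
   words being a morphism of [C] between their tensor products. Concatenation makes it
   permutative ([word_smcat]), the coherence of [C] being absorbed
   into the action of the tensor product on morphisms. Taking tensor products of words
   is an equivalence to [C], and the construction, applied to the inclusion of
   C( * ) into Csp, turns the projection of [C] into a strict functor that
   sends a word to its length. The conditions [lcc_free], [lcc_reduced] and
   [lcc_pullback] are inherited from [C] ([word_is_lcc]) because invertible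
   cospans are graphs of bijections ([cospan_iso_graph]), so that composing with
   them affects neither connectedness nor reducedness. *)

(** * Isomorphisms and identities *)

Lemma is_identity_eq (C : category) (a b : C) (f g : Hom a b) :
  is_identity f -> is_identity g -> f = g.
Proof. by move=> hf hg; apply/hom_eqE/is_identity_hom_eq. Qed.

Lemma is_identity_cancelr (C : category) (a b c : C) (g : Hom b c) (f : Hom a b) :
  is_identity f -> is_identity (g ∘ f) -> is_identity g.
Proof. by move=> h; case: h g => g; rewrite cmpm1. Qed.

Definition iso_of_eq (C : category) (a b : C) (e : a = b) : iso a b :=
  match e with erefl => iso_id a end.

Lemma iso_of_eq_identity (C : category) (a b : C) (e : a = b) :
  is_identity (iso_of_eq e).
Proof. by case: _ / e. Qed.

Definition iso_inv (C : category) (a b : C) (f : iso a b) : iso b a :=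
  Iso (bwdK f) (fwdK f).

Lemma tens_isoK (C : smcat) (a a' b b' : C) (f : iso a a') (g : iso b b') :
  (bwd f ⊠ bwd g) ∘ (f ⊠ g) = idm (a ⊗ b).
Proof. by rewrite -tensmM !fwdK tensm1. Qed.

Definition iso_tens (C : smcat) (a a' b b' : C) (f : iso a a') (g : iso b b') :
    iso (a ⊗ b) (a' ⊗ b') :=
  Iso (tens_isoK f g) (tens_isoK (iso_inv f) (iso_inv g)).

Lemma is_iso_ex (C : category) (a b : C) (f : Hom a b) :
  is_iso f -> exists g : iso a b, fwd g = f.
Proof. by move=> [g [gf fg]]; exists (Iso gf fg). Qed.

Lemma fwdKA (C : category) (a b c : C) (f : iso a b) (g : Hom c a) :
  bwd f ∘ (f ∘ g) = g.
Proof. by rewrite cmpA fwdK cmp1m. Qed.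

Lemma bwdKA (C : category) (a b c : C) (f : iso a b) (g : Hom c b) :
  f ∘ (bwd f ∘ g) = g.
Proof. by rewrite cmpA bwdK cmp1m. Qed.

Lemma iso_epi (C : category) (a b c : C) (f : iso a b) (g h : Hom b c) :
  g ∘ f = h ∘ f -> g = h.
Proof.
by move/(congr1 (fun k => k ∘ bwd f)); rewrite -!cmpA bwdK !cmpm1.
Qed.

Lemma iso_mono (C : category) (a b c : C) (f : iso b c) (g h : Hom a b) :
  f ∘ g = f ∘ h -> g = h.
Proof. by move/(congr1 (cmp (bwd f))); rewrite !fwdKA. Qed.

(** * Coherence for the unit of a monoidal category *)

(** Rewriting a composite of two morphisms inside a right-nested composite. *)
Lemma cmpAE (C : category) (a b c : C) (g : Hom b c) (f : Hom a b) (h : Hom a c) :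
  g ∘ f = h -> forall d (k : Hom d a), g ∘ (f ∘ k) = h ∘ k.
Proof. by move=> <- d k; rewrite cmpA. Qed.

Section Kelly.
Variable C : smcat.
Implicit Types a b c d : C.

Lemma tensm1_inj a b (f g : Hom a b) :
  idm (munit : C) ⊠ f = idm munit ⊠ g -> f = g.
Proof.
move=> e; apply: (@iso_epi _ _ _ _ (lunit a)).
by rewrite -!lunit_nat e.
Qed.

Lemma tensm1r_inj a b (f g : Hom a b) :
  f ⊠ idm (munit : C) = g ⊠ idm munit -> f = g.
Proof.
move=> e; apply: (@iso_epi _ _ _ _ (runit a)).
by rewrite -!runit_nat e.
Qed.

Lemma pentagon_r a b c d :
  (idm a ⊠ assoc b c d) ∘ (assoc a (b ⊗ c) d ∘ (assoc a b c ⊠ idm d)) =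
  assoc a b (c ⊗ d) ∘ assoc (a ⊗ b) c d.
Proof. by rewrite pentagon cmpA. Qed.

(** Kelly's observation: tensoring with the unit is faithful, and after
   tensoring with it the claim is the pentagon at (1, 1, a, b) combined with
   two triangles. The proof of [runit_tens] is its mirror image. *)
Lemma lunit_tens a b : lunit (a ⊗ b) ∘ assoc munit a b = lunit a ⊠ idm b.
Proof.
apply: tensm1_inj.
apply: (@iso_epi _ _ _ _ (assoc munit (munit ⊗ a) b)).
apply: (@iso_epi _ _ _ _ (iso_tens (assoc munit munit a) (iso_id b))) => /=.
rewrite tensm_cmpr -!cmpA pentagon_r (cmpAE (triangle _ _)).
rewrite -(tensm1 a b) -assoc_nat (cmpAE (esym (assoc_nat _ _ _))) -!cmpA.
by rewrite -tensmM cmp1m triangle.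
Qed.

Lemma runit_tens a b : (idm a ⊠ runit b) ∘ assoc a b munit = runit (a ⊗ b).
Proof.
apply: tensm1r_inj; rewrite tensm_cmpl.
apply: (@iso_mono _ _ _ _ (assoc a b munit)).
rewrite (cmpAE (assoc_nat _ _ _)) -!cmpA -triangle tensm_cmpr.
rewrite -triangle -(tensm1 a b) (cmpAE (assoc_nat _ _ _)) -!cmpA.
by rewrite -pentagon_r (cmpAE (esym (tensm_cmpr _ _ _))) triangle.
Qed.

Lemma lunit_runit : fwd (lunit (munit : C)) = runit munit.
Proof.
apply: tensm1_inj; apply: (@iso_epi _ _ _ _ (assoc munit munit munit)).
rewrite triangle runit_tens.
by apply: (@iso_mono _ _ _ _ (runit munit)); rewrite runit_nat.
Qed.

End Kelly.

(** * Tensor products of families *)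

Section Families.
Variables (C : smcat) (T : Type) (q : T -> C).
Implicit Types (x : T) (s t u : seq T).

Definition tens_map s : C := tens_seq (map q s).

(** The associator brings the head of [s] to the front; taking the family [q]
   as an argument of the tensor product, rather than a word of objects, avoids a
   cast along [map_cat]. *)
Fixpoint tens_cat s t : iso (tens_map s ⊗ tens_map t) (tens_map (s ++ t)) :=
  match s with
  | [::] => lunit (tens_map t)
  | x :: s' => iso_cmp (iso_tens (iso_id (q x)) (tens_cat s' t))
                       (assoc (q x) (tens_map s') (tens_map t))
  end.

Lemma tens_cat_permutative s t : is_permutative C -> is_identity (tens_cat s t).
Proof.
case=> A L R; elim: s => [|x s IH] /=; first exact: L.
apply: is_identity_cmp; first exact: A.
exact: is_identity_tensm.
Qed.

End Families.

Section FamilyMaps.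
Variables (C : smcat) (T : Type).

Fixpoint tens_map_iso (q q' : T -> C) (k : forall x, iso (q x) (q' x)) (s : seq T) :
    iso (tens_map q s) (tens_map q' s) :=
  match s with
  | [::] => iso_id munit
  | x :: s' => iso_tens (k x) (tens_map_iso k s')
  end.

Lemma tens_map_iso_cat (q q' : T -> C) (k : forall x, iso (q x) (q' x)) s t :
  tens_map_iso k (s ++ t) ∘ tens_cat q s t =
  tens_cat q' s t ∘ (tens_map_iso k s ⊠ tens_map_iso k t).
Proof.
elim: s => [|x s IH] /=; first by rewrite lunit_nat.
rewrite -!cmpA assoc_nat !cmpA -!tensmM IH.
by rewrite cmpm1 cmp1m.
Qed.

Variables (D : smcat) (F : smfunctor C D) (q : T -> C).

(** The n-ary structure map of a monoidal functor. *)
Fixpoint tens_map_fun (s : seq T) :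
    iso (tens_map (fun x => F (q x)) s) (F (tens_map q s)) :=
  match s with
  | [::] => smF0 F
  | x :: s' => iso_cmp (smF2 F (q x) (tens_map q s'))
                       (iso_tens (iso_id (F (q x))) (tens_map_fun s'))
  end.

Lemma tens_map_fun_cat s t :
  tens_map_fun (s ++ t) ∘ tens_cat (fun x => F (q x)) s t =
  fmap F (tens_cat q s t)
    ∘ (smF2 F (tens_map q s) (tens_map q t) ∘ (tens_map_fun s ⊠ tens_map_fun t)).
Proof.
elim: s => [|x s IH] /=.
  rewrite -[X in _ ⊠ X]cmp1m -[fwd (smF0 F)]cmpm1.
  by rewrite tensmM !cmpA smF2_lunit lunit_nat.
rewrite -!cmpA (cmpAE (esym (tensmM _ _ _ _))) cmp1m IH tensm_cmpr -!cmpA.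
rewrite -(fmap1 F (q x)) (cmpAE (smF2_nat _ _ _)) fmapM -!cmpA; congr (_ ∘ _).
rewrite fmap1 tensm_cmpr -!cmpA -assoc_nat.
have -> : (smF2 F (q x) (tens_map q s) ∘ (idm (F (q x)) ⊠ tens_map_fun s))
    ⊠ tens_map_fun t = (smF2 F (q x) (tens_map q s) ⊠ idm _)
    ∘ ((idm (F (q x)) ⊠ tens_map_fun s) ⊠ tens_map_fun t).
  by rewrite -tensmM cmp1m.
by rewrite !cmpA smF2_assoc.
Qed.

End FamilyMaps.

(** * Monoidal natural isomorphisms *)

Definition mnat_iso (C D : smcat) (F G : smfunctor C D) : Prop :=
  exists t : mnat F G, forall c, is_iso (t c).

Section MnatIso.
Variables C D : smcat.
Implicit Types F G H : smfunctor C D.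

Lemma mnat_iso_trans F G H : mnat_iso F G -> mnat_iso G H -> mnat_iso F H.
Proof.
move=> [t ti] [s si]; exists (mnat_cmp s t) => c.
exact: (is_iso_cmp (si c) (ti c)).
Qed.

Lemma mnat_inv_ex F G (t : mnat F G) : (forall c, is_iso (t c)) ->
  exists s : mnat G F, forall c, s c ∘ t c = idm (F c) /\ t c ∘ s c = idm (G c).
Proof.
move=> ti; pose i c := sval (cid (is_iso_ex (ti c))).
have iE c : fwd (i c) = t c by rewrite /i; case: cid.
have nat a b (f : Hom a b) : bwd (i b) ∘ fmap G f = fmap F f ∘ bwd (i a).
  apply: (iso_mono (f := i b)); rewrite bwdKA cmpA iE tr_nat -iE -cmpA bwdK.
  by rewrite cmpm1.
have p a b : NatTrans nat (a ⊗ b) ∘ smF2 G a b =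
    smF2 F a b ∘ (NatTrans nat a ⊠ NatTrans nat b).
  apply: (iso_mono (f := i (a ⊗ b))); rewrite bwdKA iE cmpA mtr_tens -!iE.
  by rewrite -cmpA -tensmM !bwdK tensm1 cmpm1.
have q : NatTrans nat munit ∘ smF0 G = smF0 F.
  by apply: (iso_mono (f := i munit)); rewrite bwdKA iE mtr_unit.
by exists (MNat p q) => c; rewrite -iE /= fwdK bwdK.
Qed.

Lemma mnat_iso_sym F G : mnat_iso F G -> mnat_iso G F.
Proof.
move=> [t /mnat_inv_ex [s sP]]; exists s => c.
by exists (t c); have [] := sP c.
Qed.

Lemma mnat_iso_whiskl (E : smcat) (K : smfunctor D E) F G :
  mnat_iso F G -> mnat_iso (smfunctor_comp K F) (smfunctor_comp K G).
Proof.
move=> [t ti]; exists (mnat_whiskl K t) => c.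
exact: (is_iso_fmap K (ti c)).
Qed.

Lemma mnat_iso_whiskr (E : smcat) (K : smfunctor E C) F G :
  mnat_iso F G -> mnat_iso (smfunctor_comp F K) (smfunctor_comp G K).
Proof. by move=> [t ti]; exists (mnat_whiskr t K) => c; apply: ti. Qed.

End MnatIso.

(** * Lifting along fully faithful functors *)

Definition fully_faithful (A B : category) (I : functor A B) : Prop :=
  forall (a b : A) (f : Hom (I a) (I b)), exists! h : Hom a b, fmap I h = f.

Section Lift.
Variables (A B : category) (I : functor A B) (Iff : fully_faithful I).

Definition preim (a b : A) (f : Hom (I a) (I b)) : Hom a b :=
  sval (cid (Iff f)).

Lemma preimK (a b : A) (f : Hom (I a) (I b)) : fmap I (preim f) = f.
Proof. by rewrite /preim; case: cid => h []. Qed.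

Lemma fmap_inj (a b : A) (f g : Hom a b) : fmap I f = fmap I g -> f = g.
Proof.
by have [h [_ hu]] := Iff (fmap I g) => /[dup] /hu <- _; apply: hu.
Qed.

Lemma preim_isoK (a b : A) (f : iso (I a) (I b)) :
  preim (bwd f) ∘ preim f = idm a.
Proof. by apply: fmap_inj; rewrite fmapM !preimK fwdK fmap1. Qed.

Definition preim_iso (a b : A) (f : iso (I a) (I b)) : iso a b :=
  Iso (preim_isoK f) (preim_isoK (iso_inv f)).

Lemma preim_iso_fwd (a b : A) (f : iso (I a) (I b)) : fmap I (preim_iso f) = f.
Proof. exact: preimK. Qed.

Lemma is_iso_preim (a b : A) (f : Hom a b) : is_iso (fmap I f) -> is_iso f.
Proof.
case/is_iso_ex => g ge; exists (preim (bwd g)).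
by split; apply: fmap_inj; rewrite fmapM preimK fmap1 -ge ?fwdK ?bwdK.
Qed.

Variables (D : category) (Q : functor D B) (q : D -> A).
Variable k : forall d, iso (I (q d)) (Q d).

Definition lift_mor (c d : D) (f : Hom c d) : Hom (q c) (q d) :=
  preim (bwd (k d) ∘ (fmap Q f ∘ k c)).

Lemma lift_morE (c d : D) (f : Hom c d) :
  k d ∘ fmap I (lift_mor f) = fmap Q f ∘ k c.
Proof. by rewrite preimK bwdKA. Qed.

(** Given only an isomorphism [k d] from [I (q d)] to [Q d] for each object,
   conjugation by [k] moves the morphisms of [Q] into the image of [I]. The
   object part is [q] on the nose, so that strictness on objects can be imposed in
   advance by the choice of [q]. *)
Definition lift_functor : functor D A.
Proof.
apply: (@Functor D A q lift_mor).
- move=> c; apply: fmap_inj; apply: (iso_mono (f := k c)).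
  by rewrite lift_morE !fmap1 cmp1m cmpm1.
- move=> a b c g f; apply: fmap_inj; apply: (iso_mono (f := k c)).
  by rewrite lift_morE !fmapM cmpA lift_morE -!cmpA lift_morE.
Defined.

End Lift.

Section LiftMonoidal.
Variables (A B : smcat) (I : smfunctor A B) (Iff : fully_faithful I).
Variables (D : smcat) (Q : smfunctor D B) (q : D -> A).
Variable k : forall d, iso (I (q d)) (Q d).

Let L := lift_functor Iff k.

(** The structure map is forced by the requirement that [k] be monoidal; the
   same requirement then yields each coherence law of the lift from those of [I]
   and [Q], after cancelling the isomorphisms [k] and [smF2 I]. *)
Lemma lift_F2_ex (a b : D) : exists f : iso (q a ⊗ q b) (q (a ⊗ b)),
  k (a ⊗ b) ∘ (fmap I f ∘ smF2 I (q a) (q b)) = smF2 Q a b ∘ (k a ⊠ k b).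
Proof.
exists (preim_iso Iff (iso_cmp (iso_inv (k (a ⊗ b))) (iso_cmp (smF2 Q a b)
    (iso_cmp (iso_tens (k a) (k b)) (iso_inv (smF2 I (q a) (q b))))))).
by rewrite preim_iso_fwd /= -!cmpA fwdK cmpm1 bwdKA.
Qed.

Lemma lift_F0_ex : exists f : iso munit (q munit),
  k munit ∘ (fmap I f ∘ smF0 I) = smF0 Q.
Proof.
exists (preim_iso Iff (iso_cmp (iso_inv (k munit))
    (iso_cmp (smF0 Q) (iso_inv (smF0 I))))).
by rewrite preim_iso_fwd /= -!cmpA fwdK cmpm1 bwdKA.
Qed.

Definition lift_F2 (a b : D) := sval (cid (lift_F2_ex a b)).
Definition lift_F0 := sval (cid lift_F0_ex).
Definition lift_F2E (a b : D) := svalP (cid (lift_F2_ex a b)).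
Definition lift_F0E := svalP (cid lift_F0_ex).

Lemma lift_F2_nat (a a' b b' : D) (f : Hom a a') (g : Hom b b') :
  lift_F2 a' b' ∘ (fmap L f ⊠ fmap L g) = fmap L (f ⊠ g) ∘ lift_F2 a b.
Proof.
apply: (fmap_inj Iff); apply: (iso_mono (f := k (a' ⊗ b'))).
apply: (iso_epi (f := smF2 I (q a) (q b))).
rewrite !fmapM -!cmpA -smF2_nat (cmpA (k _) (fmap I (fmap L _))) lift_morE.
rewrite -cmpA lift_F2E (cmpA (fmap I (lift_F2 a' b'))) (cmpA (k _)) lift_F2E.
by rewrite -!cmpA -tensmM !lift_morE tensmM !cmpA smF2_nat.
Qed.

Lemma lift_F2_assoc (a b c : D) :
  fmap L (assoc a b c) ∘ lift_F2 (a ⊗ b) c ∘ (lift_F2 a b ⊠ idm (L c)) =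
  lift_F2 a (b ⊗ c) ∘ (idm (L a) ⊠ lift_F2 b c) ∘ assoc (L a) (L b) (L c).
Proof.
apply: (fmap_inj Iff); apply: (iso_mono (f := k (a ⊗ (b ⊗ c)))).
apply: (iso_epi (f := smF2 I (q a ⊗ q b) (q c))).
apply: (iso_epi (f := iso_tens (smF2 I (q a) (q b)) (iso_id (I (q c))))) => /=.
have I_assoc := smF2_assoc I (q a) (q b) (q c); rewrite -!cmpA in I_assoc.
rewrite !fmapM -!cmpA I_assoc.
rewrite (cmpA (k _)) lift_morE (cmpAE (esym (smF2_nat I _ _))) -!cmpA fmap1 -tensm_cmpl.
rewrite (cmpA (fmap I _)) (cmpAE (lift_F2E _ _)) -!cmpA -tensmM cmpm1.
rewrite lift_F2E.
rewrite (cmpAE (esym (smF2_nat I _ _))) -!cmpA fmap1 (cmpAE (esym (tensm_cmpr _ _ _ ))).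
rewrite (cmpA (fmap I _)) (cmpAE (lift_F2E _ _)) -!cmpA.
rewrite (cmpAE (esym (tensmM _ _ _ _))) cmpm1 lift_F2E.
rewrite -[X in X ⊠ (_ ∘ _)]cmp1m tensmM -cmpA -assoc_nat.
rewrite -[X in (_ ∘ _) ⊠ X]cmp1m tensmM.
by rewrite !cmpA smF2_assoc.
Qed.

Lemma lift_F2_lunit (a : D) :
  fmap L (lunit a) ∘ lift_F2 munit a ∘ (lift_F0 ⊠ idm (L a)) = lunit (L a).
Proof.
apply: (fmap_inj Iff); apply: (iso_mono (f := k a)).
apply: (iso_epi (f := smF2 I munit (q a))).
apply: (iso_epi (f := iso_tens (smF0 I) (iso_id (I (q a))))) => /=.
rewrite !fmapM -!cmpA (cmpA (fmap I (lunit _))) smF2_lunit.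
rewrite (cmpA (k _)) lift_morE (cmpAE (esym (smF2_nat I _ _))) -!cmpA fmap1 -tensm_cmpl.
rewrite (cmpA (fmap I _)) (cmpAE (lift_F2E _ _)) -!cmpA -tensmM cmpm1.
rewrite lift_F0E -[X in _ ⊠ X]cmp1m -[X in X ⊠ _]cmpm1 tensmM !cmpA smF2_lunit.
exact: lunit_nat.
Qed.

Lemma lift_F2_runit (a : D) :
  fmap L (runit a) ∘ lift_F2 a munit ∘ (idm (L a) ⊠ lift_F0) = runit (L a).
Proof.
apply: (fmap_inj Iff); apply: (iso_mono (f := k a)).
apply: (iso_epi (f := smF2 I (q a) munit)).
apply: (iso_epi (f := iso_tens (iso_id (I (q a))) (smF0 I))) => /=.
rewrite !fmapM -!cmpA (cmpA (fmap I (runit _))) smF2_runit.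
rewrite (cmpA (k _)) lift_morE (cmpAE (esym (smF2_nat I _ _))) -!cmpA fmap1 -tensm_cmpr.
rewrite (cmpA (fmap I _)) (cmpAE (lift_F2E _ _)) -!cmpA -tensmM cmpm1.
rewrite lift_F0E -[X in X ⊠ _]cmp1m -[X in _ ⊠ X]cmpm1 tensmM !cmpA smF2_runit.
exact: runit_nat.
Qed.

Lemma lift_F2_braid (a b : D) :
  fmap L (braid a b) ∘ lift_F2 a b = lift_F2 b a ∘ braid (L a) (L b).
Proof.
apply: (fmap_inj Iff); apply: (iso_mono (f := k (b ⊗ a))).
apply: (iso_epi (f := smF2 I (q a) (q b))).
rewrite !fmapM -!cmpA smF2_braid (cmpA (k _)) lift_morE -cmpA lift_F2E.
rewrite (cmpA (fmap I _)) (cmpAE (lift_F2E _ _)) -!cmpA -braid_nat !cmpA.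
by rewrite smF2_braid.
Qed.

Definition lift_smfunctor : smfunctor D A :=
  @SMFunctor D A L lift_F2 lift_F0 lift_F2_nat lift_F2_assoc
    lift_F2_lunit lift_F2_runit lift_F2_braid.

Definition lift_nat : mnat (smfunctor_comp I lift_smfunctor) Q :=
  @MNat D B (smfunctor_comp I lift_smfunctor) Q
    (@NatTrans D B (smfunctor_comp I lift_smfunctor) Q (fun d => k d)
       (fun a b f => lift_morE Iff k f))
    lift_F2E lift_F0E.

Lemma lift_nat_iso : mnat_iso (smfunctor_comp I lift_smfunctor) Q.
Proof. by exists lift_nat => d; apply: is_iso_iso. Qed.

End LiftMonoidal.

(** Preimages of the components inherit naturality and monoidality, as these
   are equations that a faithful functor reflects. *)
Lemma mnat_iso_preim (A B D : smcat) (I : smfunctor A B) (F G : smfunctor D A) :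
  fully_faithful I ->
  mnat_iso (smfunctor_comp I F) (smfunctor_comp I G) -> mnat_iso F G.
Proof.
move=> Iff [t ti]; pose p d := preim Iff (t d).
have pE d : fmap I (p d) = t d by apply: preimK.
have nat a b (f : Hom a b) : p b ∘ fmap F f = fmap G f ∘ p a.
  by apply: (fmap_inj Iff); rewrite !fmapM !pE; apply: (tr_nat t).
have p2 a b : NatTrans nat (a ⊗ b) ∘ smF2 F a b =
    smF2 G a b ∘ (NatTrans nat a ⊠ NatTrans nat b).
  apply: (fmap_inj Iff); apply: (iso_epi (f := smF2 I (F a) (F b))).
  have /= e := mtr_tens t a b.
  by rewrite !fmapM pE -!cmpA e -smF2_nat !pE cmpA.
have p0 : NatTrans nat munit ∘ smF0 F = smF0 G.
  apply: (fmap_inj Iff); apply: (iso_epi (f := smF0 I)).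
  have /= e := mtr_unit t.
  by rewrite !fmapM pE -!cmpA e.
by exists (MNat p2 p0) => d; apply: (is_iso_preim Iff); rewrite pE; apply: ti.
Qed.

Lemma ff_is_equivalence (A B : category) (I : functor A B) :
  fully_faithful I -> (forall b, exists a, inhabited (iso (I a) b)) ->
  is_equivalence I.
Proof.
move=> Iff es; pose q b := sval (cid (es b)).
have inh b : exists f : iso (I (q b)) b, True.
  by rewrite /q; case: cid => a /= [f]; exists f.
pose k b := sval (cid (inh b)).
pose G := @lift_functor A B I Iff B (functor_id B) q k.
have GE b b' (f : Hom b b') : k b' ∘ fmap I (fmap G f) = f ∘ k b.
  exact: (lift_morE Iff (Q := functor_id B) k f).
exists G; split.
  pose u a := preim_iso Iff (iso_inv (k (I a))).
  have uE a : fmap I (u a) = bwd (k (I a)) by exact: preim_iso_fwd.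
  have nat a b (f : Hom a b) :
      u b ∘ fmap (functor_id A) f = fmap (functor_comp G I) f ∘ u a.
    apply: (fmap_inj Iff); apply: (iso_mono (f := k (I b))).
    by rewrite !fmapM !uE bwdKA cmpA [in RHS]GE -cmpA bwdK cmpm1.
  exists (@NatTrans _ _ (functor_id A) (functor_comp G I) (fun a => u a) nat) => a.
  exact: (is_iso_iso (u a)).
by exists (@NatTrans _ _ (functor_comp I G) (functor_id B) (fun b => k b) GE) => b;
  apply: is_iso_iso.
Qed.

(** * Strict lifts *)

Section StrictLift.
Variables (A B : smcat) (I : smfunctor A B) (Iff : fully_faithful I).
Variables (D : smcat) (Q : smfunctor D B).
Hypotheses (Aperm : is_permutative A) (Dperm : is_permutative D).
Variables (T : Type) (tau : T -> D) (dec : D -> seq T).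
Hypothesis decK : forall d, tens_map tau (dec d) = d.
Hypothesis dec1 : dec munit = [::].
Hypothesis decM : forall a b, dec (a ⊗ b) = dec a ++ dec b.
Variables (q0 : T -> A) (k0 : forall x, iso (I (q0 x)) (Q (tau x))).

Definition strict_ob (d : D) : A := tens_map q0 (dec d).

Definition strict_seq_iso (s : seq T) :
    iso (I (tens_map q0 s)) (Q (tens_map tau s)) :=
  iso_cmp (tens_map_fun Q tau s)
    (iso_cmp (tens_map_iso k0 s) (iso_inv (tens_map_fun I q0 s))).

(** This is what makes the lift strict: the comparison isomorphisms of words turn
   the structure maps of [I] and [Q] into concatenation isomorphisms, which in
   permutative categories are identities. *)
Lemma strict_seq_iso_cat s t :
  strict_seq_iso (s ++ t)
    ∘ (fmap I (tens_cat q0 s t) ∘ smF2 I (tens_map q0 s) (tens_map q0 t)) =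
  fmap Q (tens_cat tau s t) ∘ (smF2 Q (tens_map tau s) (tens_map tau t)
    ∘ (strict_seq_iso s ⊠ strict_seq_iso t)).
Proof.
apply: (iso_epi (f := iso_tens (tens_map_fun I q0 s) (tens_map_fun I q0 t))).
rewrite /= -!cmpA -tens_map_fun_cat (cmpAE (fwdK _)) cmp1m tens_map_iso_cat.
rewrite (cmpAE (tens_map_fun_cat Q tau s t)) -!cmpA -!tensmM.
by rewrite -!cmpA !fwdK !cmpm1.
Qed.

Definition strict_iso (d : D) : iso (I (strict_ob d)) (Q d) :=
  iso_cmp (iso_fmap Q (iso_of_eq (decK d))) (strict_seq_iso (dec d)).

Let L := lift_smfunctor Iff strict_iso.

Lemma strict_lift_F2 a b : is_identity (smF2 L a b).
Proof.
(* [strict_iso] determines the structure map, so it is enough to find one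
   identity morphism that is compatible with it. *)
have [e eid eE] : exists2 e : Hom (strict_ob a ⊗ strict_ob b) (strict_ob (a ⊗ b)),
    is_identity e &
    strict_iso (a ⊗ b) ∘ (fmap I e ∘ smF2 I (strict_ob a) (strict_ob b)) =
    smF2 Q a b ∘ (strict_iso a ⊠ strict_iso b).
  rewrite /strict_iso /strict_ob.
  move: (decM a b) (decK a) (decK b) (decK (a ⊗ b)).
  move: (dec a) (dec b) (dec (a ⊗ b)) => s t u -> {u} ea eb eab.
  exists (tens_cat q0 s t); first exact: tens_cat_permutative.
  case: _ / ea eab => eab; case: _ / eb eab => eab.
  change (fmap Q (iso_of_eq eab) ∘ strict_seq_iso (s ++ t)
    ∘ (fmap I (tens_cat q0 s t) ∘ smF2 I (tens_map q0 s) (tens_map q0 t)) =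
    smF2 Q (tens_map tau s) (tens_map tau t)
    ∘ ((fmap Q (idm _) ∘ strict_seq_iso s) ⊠ (fmap Q (idm _) ∘ strict_seq_iso t))).
  rewrite -cmpA strict_seq_iso_cat !fmap1 !cmp1m.
  rewrite (cmpA (fmap Q _)) -fmapM.
  set i := iso_of_eq eab ∘ _; suff -> : i = idm _ by rewrite fmap1 cmp1m.
  apply: is_identity_eq => //; rewrite /i.
  apply: is_identity_cmp; first exact: tens_cat_permutative.
  exact: iso_of_eq_identity.
suff <- : e = lift_F2 Iff strict_iso a b by [].
apply: (fmap_inj Iff); apply: (iso_epi (f := smF2 I (strict_ob a) (strict_ob b))).
by apply: (iso_mono (f := strict_iso (a ⊗ b))); rewrite eE lift_F2E.
Qed.

Lemma strict_lift_F0 : is_identity (smF0 L).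
Proof.
have [e eid eE] : exists2 e : Hom munit (strict_ob munit), is_identity e &
    strict_iso munit ∘ (fmap I e ∘ smF0 I) = smF0 Q.
  rewrite /strict_iso /strict_ob; move: dec1 (decK munit).
  move: (dec munit) => s -> {s} e; exists (idm munit) => //.
  rewrite /= fmap1 !cmp1m -!cmpA fwdK cmpm1.
  suff -> : fwd (iso_of_eq e) = idm _ by rewrite fmap1 cmp1m.
  by apply: is_identity_eq => //; apply: iso_of_eq_identity.
suff <- : e = lift_F0 Iff strict_iso by [].
apply: (fmap_inj Iff); apply: (iso_epi (f := smF0 I)).
by apply: (iso_mono (f := strict_iso munit)); rewrite eE lift_F0E.
Qed.

Lemma strict_lift_ex : exists F : smfunctor D A,
  [/\ is_strict F, forall d, F d = tens_map q0 (dec d)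
    & mnat_iso (smfunctor_comp I F) Q].
Proof.
exists L; split=> //; last exact: lift_nat_iso.
by split; [exact: strict_lift_F2|exact: strict_lift_F0].
Qed.

End StrictLift.

(** * Isomorphisms of cospans *)

Lemma pushout_inj (B X Y P : finType) (f : B -> X) (g : B -> Y)
    (i : X -> P) (j : Y -> P) :
  is_pushout f g i j -> injective g -> injective i.
Proof.
move=> [_ ds _] gi.
(* A map out of the pushout that separates the points of [X]. *)
pose v y : option X := if [pick b | g b == y] is Some b then Some (f b) else None.
have [b|h [hi _]] := ds _ Some v.
  by rewrite /v; case: pickP => [b' /eqP /gi ->//|/(_ b)]; rewrite eqxx.
by move=> x x' /(congr1 h); rewrite !hi => -[].
Qed.

(** As both composites with the inverse are identities, the legs of the two cospans
   are split by the structure maps of the two pushouts. So the legs are injective,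
   hence so are the structure maps, and an injective retraction is bijective. *)
Lemma cospan_iso_graph (U : fin_universe) (A B : csp_smcat U) (u : Hom A B) :
  is_iso u -> exists f : El A -> El B, bijective f /\ u = class_graph f.
Proof.
case=> v [vu uv]; have [x xE] := class_ofP u; have [y yE] := class_ofP v.
have [z zP] := composite_exists x y; have [w wP] := composite_exists y x.
have /class_of_eq [hz [hzb hzl hzr]] : class_of z = class_graph id.
  by rewrite -(class_cmpE zP) -xE -yE -[RHS]vu.
have /class_of_eq [hw [hwb hwl hwr]] : class_of w = class_graph id.
  by rewrite -(class_cmpE wP) -xE -yE -[RHS]uv.
move: zP => [i [j [po zl zr]]]; move: wP => [i' [j' [po' wl wr]]].
have il a : hz (i (lleg x a)) = a by rewrite -zl hzl.
have jr b : hw (j' (rleg x b)) = b by rewrite -wr hwr.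
have i'l b : hw (i' (lleg y b)) = b by rewrite -wl hwl.
have jr' a : hz (j (rleg y a)) = a by rewrite -zr hzr.
have li : injective i.
  apply: (pushout_inj po); exact: (can_inj (g := fun p => hw (i' p))).
have ri : injective j'.
  have po'' : is_pushout (@lleg _ _ _ x) (@rleg _ _ _ y) j' i'.
    case: po' => sq ds un; split=> [b|T s t st|T h h' hi hj p].
    - by rewrite sq.
    - have [h [h1 h2]] := ds T t s (fun b => esym (st b)).
      by exists h.
    - exact: un.
  apply: (pushout_inj po''); exact: (can_inj (g := fun p => hz (j p))).
have lK : cancel (fun p => hz (i p)) (@lleg _ _ _ x).
  by move=> p; apply: li; apply: (bij_inj hzb); rewrite il.
have rK : cancel (fun p => hw (j' p)) (@rleg _ _ _ x).
  by move=> p; apply: ri; apply: (bij_inj hwb); rewrite jr.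
exists (fun a => hw (j' (lleg x a))); split.
  exists (fun b => hz (i (rleg x b))) => [a|b]; first by rewrite rK il.
  by rewrite lK jr.
rewrite xE; apply/class_of_eq; exists (fun p => hw (j' p)); split=> //.
by exists (@rleg _ _ _ x) => [|b]; [exact: rK|exact: jr].
Qed.

Lemma cospan_iso_card (U : fin_universe) (A B : csp_smcat U) (u : Hom A B) :
  is_iso u -> #|El A| = #|El B|.
Proof. by move=> /cospan_iso_graph [f [/bij_eq_card]]. Qed.

(** * Rigidity over the category of cospans of ordinals *)

Lemma cstar_iso_identity (m n : Cstar) (u : Hom m n) :
  is_iso u -> #|El (n : ordinal_universe)| = 1 -> is_identity u.
Proof.
move=> ui n1; have := cospan_iso_card ui; have [f [_ ->]] := cospan_iso_graph ui.
move: f n1; rewrite !card_ord => f n1 mn.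
apply: ordinal_graph_identity; first exact: mn.
move: mn f; rewrite /= n1 => -> f i.
by rewrite (ord1 i) (ord1 (f _)).
Qed.

Section Rigidity.
Variables (C : smcat) (F G : smfunctor C Cstar).
Hypotheses (Fs : is_strict F) (Gs : is_strict G).
Variables (t : mnat F G) (ti : forall c, is_iso (t c)).

(** Monoidality reduces the claim to the letters of [s], and the only invertible
   cospan between one-point ordinals is the identity. *)
Lemma strict_nat_identity (s : seq C) :
  List.Forall (@connected_ob ordinal_universe C G) s ->
  is_identity (t (tens_seq s)).
Proof.
elim: s => [|c s IH] /= Gc.
  apply: (is_identity_cancelr (f := smF0 F)); first exact: Fs.2.
  rewrite mtr_unit; exact: Gs.2.
have [c1 s1] : connected_ob G c /\ List.Forall (connected_ob G) s.
  by inversion Gc.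
apply: (is_identity_cancelr (f := smF2 F c (tens_seq s))); first exact: Fs.1.
rewrite mtr_tens; apply: is_identity_cmp; last exact: Gs.1.
apply: is_identity_tensm; last exact: IH.
exact: cstar_iso_identity.
Qed.

End Rigidity.

Lemma is_identity_square (C : category) (a b a' b' : C) (f : Hom a b)
    (g : Hom a' b') (u : Hom a a') (v : Hom b b') :
  is_identity u -> is_identity v -> v ∘ f = g ∘ u -> hom_eq f g.
Proof.
move=> uid; case: uid f g => f g vid; case: vid f g => f g.
by rewrite cmp1m cmpm1 => ->.
Qed.

Lemma strict_nat_eq (C D : smcat) (F G : smfunctor C D) (t : mnat F G) :
  is_strict F -> is_strict G -> (forall c, is_identity (t c)) -> F = G.
Proof.
move=> [F2 F0] [G2 G0] tid.
have ob c : F c = G c by apply: is_identity_src (tid c).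
apply: smfunctor_eq.
- apply: functor_eq => // a b f.
  exact: is_identity_square (tid a) (tid b) (tr_nat t f).
- by move=> a b; apply: is_identity_hom_eq => //; rewrite !ob.
- by apply: is_identity_hom_eq.
Qed.

(** * Equivalences of hom-categories *)

Lemma incl_ff (U : fin_universe) : fully_faithful (incl U).
Proof.
move=> A B Q; have [P PQ] := @incl_class_surj U A B Q.
by exists P; split=> // P'; rewrite -PQ => /incl_class_inj.
Qed.

(** The 2-morphisms carry no data besides the monoidal transformation, and the
   condition on them holds for every isomorphism. *)
Lemma lcc1_iso (X Y : lcc) (f g : lcc1 X Y) :
  mnat_iso (l1_fun f) (l1_fun g) -> inhabited (@iso (lcc_hom X Y) f g).
Proof.
move=> [t ti]; have [s sP] := mnat_inv_ex ti.
have ti' c : is_iso (fmap (lcc_pi Y) (t c)) by apply: is_iso_fmap.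
have si' c : is_iso (fmap (lcc_pi Y) (s c)).
  by apply: is_iso_fmap; exists (t c); have [] := sP c.
constructor.
apply: (@Iso (lcc_hom X Y) f g (LCC2 (@lcc2_intro _ _ f g t ti'))
                               (LCC2 (@lcc2_intro _ _ g f s si'))).
- by apply: lcc2_eq => c /=; have [] := sP c.
- by apply: lcc2_eq => c /=; have [] := sP c.
Qed.

Lemma slcc_strict_comp (X Y : slcc) (f : slcc1 X Y) :
  is_strict (smfunctor_comp (slcc_pi Y) (s1_fun f)).
Proof. exact: is_strict_comp (slcc_strict Y) (s1_strict f). Qed.

(** Fullness is rigidity: over C( * ), the given 2-morphism is a monoidal
   isomorphism between two strict functors. *)
Lemma slcc_hom_ff (X Y : slcc) : fully_faithful (slcc_to_lcc_hom X Y).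
Proof.
move=> f g l; have over c : is_identity (mnat_whiskl (slcc_pi Y) (l2_nat l) c).
  have [s [[_ sc ->] _]] := slcc_uniq c.
  apply: (strict_nat_identity (slcc_strict_comp f) (slcc_strict_comp g)).
    by move=> d; apply: (is_iso_preim (@incl_ff _) (l2_piE l d)).
  by rewrite s1_over.
exists (@SLCC2 X Y f g (l2_nat l) over); split; first by apply: lcc2_eq.
by move=> k e; apply: slcc2_eq => c; rewrite /= -e.
Qed.

Lemma Forall_sig (T : Type) (P : T -> Prop) (s : seq T) :
  List.Forall P s -> exists s' : seq {x | P x}, map sval s' = s.
Proof.
elim: s => [_|x s IH xs]; first by exists [::].
have [Px /IH [s' <-]] : P x /\ List.Forall P s by inversion xs.
by exists (exist P x Px :: s').
Qed.

Lemma sval_inj (T : Type) (P : T -> Prop) : injective (@sval T P).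
Proof.
by move=> [x p] [y q] /= e; case: _ / e q => q; rewrite (Prop_irrelevance p q).
Qed.

Section Decomposition.
Variable X : slcc.
Let T := {c : slcc_car X | connected_ob (slcc_pi X) c}.

(** Compatibility with concatenation follows from uniqueness of the decomposition,
   once the number of letters is known to be right; that number is additive
   because the projection is strict. *)
Lemma slcc_dec_ex : exists dec : slcc_car X -> seq T,
  [/\ forall c, tens_map sval (dec c) = c, dec munit = [::]
    & forall a b, dec (a ⊗ b) = dec a ++ dec b].
Proof.
have H c : exists s : seq T, size s = slcc_pi X c /\ tens_map sval s = c.
  have [s [[ss sc cE] _]] := slcc_uniq c.
  have [s' sE] := Forall_sig sc.
  by exists s'; rewrite /tens_map -(size_map sval) sE -cE.
pose dec c := sval (cid (H c)).
have [decS decK] : (forall c, size (dec c) = slcc_pi X c) /\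
    (forall c, tens_map sval (dec c) = c).
  by split=> c; rewrite /dec; case: cid => s [].
have U (s s' : seq T) : size s = slcc_pi X (tens_map sval s) ->
    size s' = slcc_pi X (tens_map sval s') ->
    tens_map sval s = tens_map sval s' -> s = s'.
  have F (u : seq T) : List.Forall (connected_ob (slcc_pi X)) (map sval u).
    by elim: u => [|[x p] u IH] /=; constructor.
  move=> ss ss' e; apply: (inj_map (@sval_inj _ _)).
  have [u [_ uU]] := slcc_uniq (tens_map sval s).
  rewrite -(uU (map sval s)); last by rewrite size_map.
  by apply: uU; rewrite size_map e.
have [pi2 pi0] := slcc_strict X.
exists dec; split=> // [|a b]; apply: U; rewrite ?decK //.
- exact: is_identity_src pi0.
- have e : tens_map sval (dec a ++ dec b) = a ⊗ b.
    have := tens_cat_permutative sval (dec a) (dec b) (slcc_perm X).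
    by move=> /is_identity_src <-; rewrite !decK.
  rewrite e size_cat !decS; exact: is_identity_src (pi2 a b).
- have := tens_cat_permutative sval (dec a) (dec b) (slcc_perm X).
  by move=> /is_identity_src <-; rewrite !decK.
Qed.

End Decomposition.

(** The strict functor is isomorphic to the given one, hence commutes with the
   projections up to isomorphism; rigidity turns this into an equality. *)
Lemma slcc_hom_es (X Y : slcc) (h : lcc_hom (slcc_to_lcc_ob X) (slcc_to_lcc_ob Y)) :
  exists f : slcc_hom X Y, inhabited (iso (slcc_to_lcc_hom X Y f) h).
Proof.
have [dec [decK dec1 decM]] := slcc_dec_ex X.
have id_ff : fully_faithful (smfunctor_id (slcc_car Y)).
  by move=> a b f; exists f; split.
have [F [Fs _]] := strict_lift_ex id_ff (slcc_perm Y) (slcc_perm X) decK dec1 decM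
  (fun x => iso_id (l1_fun h (sval x))).
rewrite smfunctor_comp1m => FH.
have Fst : is_strict (smfunctor_comp (slcc_pi Y) F).
  exact: is_strict_comp (slcc_strict Y) Fs.
have [t ti] : mnat_iso (smfunctor_comp (slcc_pi Y) F) (slcc_pi X).
  apply: (mnat_iso_preim (@incl_ff ordinal_universe)); rewrite smfunctor_compA.
  apply: mnat_iso_trans (mnat_iso_whiskl _ FH) _.
  by exists (l1_nat h); exact: (l1_iso h).
have over : smfunctor_comp (slcc_pi Y) F = slcc_pi X.
  apply: (strict_nat_eq (t := t)) => //; first exact: slcc_strict.
  move=> c; have [s [[_ sc ->] _]] := slcc_uniq c.
  by apply: strict_nat_identity => //; apply: slcc_strict.
by exists (SLCC1 Fs over); apply: lcc1_iso.
Qed.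

Lemma slcc_hom_equivalence (X Y : slcc) : is_equivalence (slcc_to_lcc_hom X Y).
Proof. exact: ff_is_equivalence (@slcc_hom_ff X Y) (@slcc_hom_es X Y). Qed.

(** * The permutative category of words *)

Section StrictCategory.
Variables (C : smcat) (T : Type) (q : T -> C).
Implicit Types s t u : seq T.

Definition word_category : category :=
  @Category (seq T) (fun s t => Hom (tens_map q s) (tens_map q t))
    (fun s => idm (tens_map q s)) (fun s t u g f => g ∘ f)
    (fun _ _ _ _ h g f => cmpA h g f) (fun _ _ f => cmp1m f)
    (fun _ _ f => cmpm1 f).

Definition word_functor : functor word_category C :=
  @Functor word_category C (tens_map q) (fun _ _ f => f)
    (fun=> erefl) (fun _ _ _ _ _ => erefl).

Lemma word_functor_ff : fully_faithful word_functor.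
Proof. by move=> s t f; exists f; split. Qed.

Local Notation D := word_category.
Local Notation P := word_functor.
Local Notation mu := (tens_cat q).

(** Locked because rewriting with associativity of composition would otherwise
   look through [word_functor] and break it up; it is only used through
   [word_tensmE]. *)
Definition word_tensm (s s' t t' : D) (f : Hom s s') (g : Hom t t') :
    @Hom D (s ++ t) (s' ++ t') :=
  locked (mu s' t' ∘ ((fmap P f ⊠ fmap P g) ∘ bwd (mu s t))).

Definition word_assoc s t u : @iso D ((s ++ t) ++ u) (s ++ t ++ u) :=
  @iso_of_eq D _ _ (esym (catA s t u)).
Definition word_lunit s : @iso D ([::] ++ s) s := @iso_id D s.
Definition word_runit s : @iso D (s ++ [::]) s := @iso_of_eq D _ _ (cats0 s).
Definition word_braid s t : @iso D (s ++ t) (t ++ s) :=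
  preim_iso word_functor_ff
    (iso_cmp (mu t s) (iso_cmp (braid _ _) (iso_inv (mu s t))) :
       iso (P (s ++ t)) (P (t ++ s))).

Lemma word_tensmE (s s' t t' : D) (f : Hom s s') (g : Hom t t') :
  fmap P (word_tensm f g) ∘ mu s t = mu s' t' ∘ (fmap P f ⊠ fmap P g).
Proof. by rewrite /word_tensm -lock /= -!cmpA fwdK cmpm1. Qed.

Lemma word_cons_eq x s t (e : x :: s = x :: t) (e' : s = t) :
  fmap P (@iso_of_eq D _ _ e) = idm (q x) ⊠ fmap P (@iso_of_eq D _ _ e').
Proof.
case: _ / e' e => e; rewrite (Prop_irrelevance e erefl) /=.
exact: esym (tensm1 _ _).
Qed.

(** This identifies the equality of the two bracketings of a concatenation with the
   associator of [C]; the coherence laws below follow from it and from those of [C]. *)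
Lemma word_assocE s t u :
  fmap P (word_assoc s t u) ∘ (mu (s ++ t) u ∘ (mu s t ⊠ idm (P u))) =
  mu s (t ++ u) ∘ ((idm (P s) ⊠ mu t u) ∘ assoc (P s) (P t) (P u)).
Proof.
elim: s => [|x s IH].
  rewrite /word_assoc (Prop_irrelevance (esym _) erefl) [fmap _ _]/=.
  by rewrite cmp1m /= -lunit_tens !cmpA lunit_nat.
rewrite (word_cons_eq _ (esym (catA s t u))) /=.
rewrite tensm_cmpl -!cmpA (cmpAE (assoc_nat _ _ _)).
have IHx := congr1 (fun f => idm (q x) ⊠ f) IH.
rewrite /= !tensm_cmpr in IHx.
rewrite -!cmpA (cmpA (idm _ ⊠ fwd (mu _ _))) (cmpA _ _ (assoc _ _ _ ∘ _)) IHx -!cmpA.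
rewrite pentagon_r; congr (_ ∘ _).
by rewrite (cmpAE (esym (assoc_nat _ _ _))) tensm1 -!cmpA.
Qed.

Lemma word_lunitE s :
  fmap P (word_lunit s) ∘ mu [::] s = lunit (P s).
Proof. exact: cmp1m. Qed.

Lemma word_runitE s : fmap P (word_runit s) ∘ mu s [::] = runit (P s).
Proof.
elim: s => [|x s IH].
  rewrite /word_runit (Prop_irrelevance (cats0 _) erefl) [fmap _ _]/= cmp1m.
  exact: lunit_runit.
rewrite (word_cons_eq _ (cats0 s)) /=.
by rewrite cmpA -tensm_cmpr [X in idm _ ⊠ X]IH runit_tens.
Qed.

Lemma word_braidE s t : fmap P (word_braid s t) ∘ mu s t = mu t s ∘ braid (P s) (P t).
Proof. by rewrite preim_iso_fwd /= -!cmpA fwdK cmpm1. Qed.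

Lemma word_tensm1 s t : word_tensm (@idm D s) (@idm D t) = @idm D (s ++ t).
Proof.
apply: (iso_epi (f := mu s t)).
by rewrite [LHS]word_tensmE /= tensm1 cmp1m cmpm1.
Qed.

Lemma word_tensmM (s s' s'' t t' t'' : D) (f' : Hom s' s'') (f : Hom s s')
    (g' : Hom t' t'') (g : Hom t t') :
  word_tensm (f' ∘ f) (g' ∘ g) = word_tensm f' g' ∘ word_tensm f g.
Proof.
apply: (iso_epi (f := mu s t)); rewrite [LHS]word_tensmE.
rewrite (fmapM P) (fmapM P) tensmM cmpA -word_tensmE -cmpA -word_tensmE.
by rewrite cmpA.
Qed.

Lemma word_epi3 s t u (w : D) (f g : @Hom D ((s ++ t) ++ u) w) :
  fmap P f ∘ (mu (s ++ t) u ∘ (mu s t ⊠ idm (P u))) =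
  fmap P g ∘ (mu (s ++ t) u ∘ (mu s t ⊠ idm (P u))) -> f = g.
Proof.
exact: (@iso_epi _ _ _ _ (iso_cmp (mu (s ++ t) u)
  (iso_tens (mu s t) (iso_id (P u)))) (fmap P f) (fmap P g)).
Qed.

Lemma word_assoc_nat (s s' t t' u u' : D) (f : Hom s s') (g : Hom t t')
    (h : Hom u u') :
  word_assoc s' t' u' ∘ word_tensm (word_tensm f g) h =
  word_tensm f (word_tensm g h) ∘ word_assoc s t u.
Proof.
apply: word_epi3; rewrite !fmapM -!cmpA word_assocE.
rewrite (cmpAE (word_tensmE (word_tensm f g) h)).
rewrite (cmpAE (word_tensmE f (word_tensm g h))).
rewrite -!cmpA -tensmM word_tensmE cmpm1 -[X in _ ⊠ X]cmp1m tensmM.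
rewrite (cmpA (fwd (mu (s' ++ t') u'))) (cmpAE (word_assocE _ _ _)) -!cmpA.
rewrite assoc_nat [in RHS](cmpAE (esym (tensmM _ _ _ _))) word_tensmE cmpm1.
by rewrite -[X in _ = _ ∘ (X ⊠ _ ∘ _)]cmp1m tensmM -cmpA.
Qed.

Lemma word_lunit_nat (s s' : D) (f : Hom s s') :
  word_lunit s' ∘ word_tensm (@idm D [::]) f = f ∘ word_lunit s.
Proof.
apply: (fmap_inj word_functor_ff); apply: (iso_epi (f := mu [::] s)).
rewrite !fmapM -!cmpA word_tensmE (cmpAE (word_lunitE _)) word_lunitE.
exact: lunit_nat.
Qed.

Lemma word_runit_nat (s s' : D) (f : Hom s s') :
  word_runit s' ∘ word_tensm f (@idm D [::]) = f ∘ word_runit s.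
Proof.
apply: (fmap_inj word_functor_ff); apply: (iso_epi (f := mu s [::])).
rewrite !fmapM -!cmpA word_tensmE (cmpAE (word_runitE _)) word_runitE.
exact: runit_nat.
Qed.

Lemma word_braid_nat (s s' t t' : D) (f : Hom s s') (g : Hom t t') :
  word_braid s' t' ∘ word_tensm f g = word_tensm g f ∘ word_braid s t.
Proof.
apply: (fmap_inj word_functor_ff); apply: (iso_epi (f := mu s t)).
rewrite !fmapM -!cmpA word_tensmE (cmpAE (word_braidE _ _)) word_braidE.
by rewrite (cmpAE (word_tensmE _ _)) -!cmpA braid_nat.
Qed.

Lemma word_assoc_identity s t u : is_identity (word_assoc s t u).
Proof. exact: iso_of_eq_identity. Qed.

Lemma word_tensm_identity (s s' t t' : D) (f : Hom s s') (g : Hom t t') :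
  is_identity f -> is_identity g -> is_identity (word_tensm f g).
Proof. by case; case; rewrite word_tensm1. Qed.

Lemma word_hexagon s t u :
  word_assoc t u s ∘ word_braid s (t ++ u) ∘ word_assoc s t u =
  word_tensm (@idm D t) (word_braid s u) ∘ word_assoc t s u
    ∘ word_tensm (word_braid s t) (@idm D u).
Proof.
apply: word_epi3; rewrite !fmapM -!cmpA word_assocE.
rewrite (cmpAE (word_braidE s (t ++ u))) -!cmpA (cmpAE (braid_nat _ _)) -!cmpA.
rewrite (cmpA (fwd (mu (t ++ u) s))) (cmpAE (word_assocE _ _ _)) -!cmpA.
rewrite (cmpAE (word_tensmE (word_braid s t) (@idm D u))) -!cmpA.
rewrite (fmap1 P u) -tensm_cmpl word_braidE tensm_cmpl.
rewrite (cmpA (fwd (mu (t ++ s) u))) (cmpAE (word_assocE _ _ _)) -!cmpA.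
rewrite (cmpAE (word_tensmE (@idm D t) (word_braid s u))) -!cmpA.
rewrite (fmap1 P t) [in RHS](cmpAE (esym (tensm_cmpr _ _ _))) word_braidE.
rewrite tensm_cmpr -!cmpA; congr (_ ∘ (_ ∘ _)).
by have := hexagon (P s) (P t) (P u); rewrite -!cmpA.
Qed.

(** All associators and unitors of words are identities, so that the pentagon and
   the triangle compare parallel identities. *)
Lemma word_pentagon s t u v :
  word_assoc s t (u ++ v) ∘ word_assoc (s ++ t) u v =
  word_tensm (@idm D s) (word_assoc t u v) ∘ word_assoc s (t ++ u) v
    ∘ word_tensm (word_assoc s t u) (@idm D v).
Proof.
have id1 := @is_identity_id D; have idA := word_assoc_identity.
apply: is_identity_eq; first exact: is_identity_cmp (idA _ _ _) (idA _ _ _).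
apply: is_identity_cmp; first exact: word_tensm_identity (idA _ _ _) (id1 _).
apply: is_identity_cmp; first exact: idA.
exact: word_tensm_identity (id1 _) (idA _ _ _).
Qed.

Lemma word_triangle s t :
  word_tensm (@idm D s) (word_lunit t) ∘ word_assoc s [::] t =
  word_tensm (word_runit s) (@idm D t).
Proof.
have id1 := @is_identity_id D; apply: is_identity_eq.
  apply: is_identity_cmp; first exact: word_assoc_identity.
  exact: word_tensm_identity (id1 _) (id1 _).
exact: word_tensm_identity (iso_of_eq_identity _) (id1 _).
Qed.

Lemma word_braidK s t : word_braid t s ∘ word_braid s t = @idm D (s ++ t).
Proof.
apply: (fmap_inj word_functor_ff); apply: (iso_epi (f := mu s t)).
rewrite fmapM -cmpA word_braidE (cmpAE (word_braidE t s)) -cmpA braidK cmpm1.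
by rewrite fmap1 cmp1m.
Qed.

Lemma word_runit_square (c d : D) (h f : Hom c d) (x : @Hom D [::] [::]) :
  h ∘ word_runit c = word_runit d ∘ word_tensm f x <->
  fmap P h ∘ runit (P c) = runit (P d) ∘ (fmap P f ⊠ fmap P x).
Proof.
have E : fmap P (word_runit d) ∘ mu d [::] ∘ (fmap P f ⊠ fmap P x) =
    fmap P (word_runit d ∘ word_tensm f x) ∘ mu c [::].
  by rewrite -cmpA -word_tensmE cmpA -fmapM.
rewrite -!word_runitE E cmpA -fmapM.
by split=> [->|/iso_epi/(fmap_inj word_functor_ff)].
Qed.

Definition word_smcat : smcat :=
  @SMCat D [::] (fun s t => s ++ t) word_tensm word_tensm1 word_tensmM
    word_assoc word_lunit word_runit word_braid word_assoc_nat word_lunit_nat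
    word_runit_nat word_braid_nat word_pentagon word_triangle word_hexagon
    word_braidK.

Lemma word_permutative : is_permutative word_smcat.
Proof.
split=> [s t u|s|s]; first exact: word_assoc_identity.
- exact: (@is_identity_id D).
- exact: (@iso_of_eq_identity D).
Qed.

Definition word_smfunctor : smfunctor word_smcat C.
Proof.
apply: (@SMFunctor word_smcat C P mu (iso_id munit)).
- by move=> s s' t t' f g; rewrite [RHS]word_tensmE.
- by move=> s t u; rewrite -!cmpA [LHS]word_assocE.
- by move=> s; rewrite tensm1 cmpm1 [LHS]word_lunitE.
- by move=> s; rewrite tensm1 cmpm1 [LHS]word_runitE.
- by move=> s t; rewrite [LHS]word_braidE.
Defined.

End StrictCategory.

(** * Equivalences of labelled cospan categories *)

Lemma mnat_iso_lcc1 (X Y : lcc) (f : smfunctor (lcc_car X) (lcc_car Y)) :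
  mnat_iso (smfunctor_comp (lcc_pi Y) f) (lcc_pi X) ->
  exists g : lcc1 X Y, l1_fun g = f.
Proof. by move=> [t ti]; exists (LCC1 ti). Qed.

(** A quasi-inverse of [P] is a lift of the identity along [P], and it lies over
   Csp because [P] does. *)
Lemma lcc_equivalence (X Y : lcc) (P : smfunctor (lcc_car X) (lcc_car Y)) :
  fully_faithful P -> (forall c, exists s, inhabited (iso (P s) c)) ->
  mnat_iso (smfunctor_comp (lcc_pi Y) P) (lcc_pi X) ->
  @equivalent_objects LCC X Y.
Proof.
move=> Pff Pes Pover; pose q c := sval (cid (Pes c)).
have inh c : exists f : iso (P (q c)) c, True.
  by rewrite /q; case: cid => a /= [f]; exists f.
pose G := @lift_smfunctor _ _ P Pff _ (smfunctor_id (lcc_car Y)) q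
  (fun c => sval (cid (inh c))).
have PG : mnat_iso (smfunctor_comp P G) (smfunctor_id _) by exact: lift_nat_iso.
have GP : mnat_iso (smfunctor_comp G P) (smfunctor_id _).
  apply: (mnat_iso_preim Pff); rewrite smfunctor_compA smfunctor_compm1.
  by rewrite -[X in mnat_iso _ X]smfunctor_comp1m; apply: mnat_iso_whiskr.
have Gover : mnat_iso (smfunctor_comp (lcc_pi X) G) (lcc_pi Y).
  apply: mnat_iso_trans (mnat_iso_whiskr G (mnat_iso_sym Pover)) _.
  rewrite -smfunctor_compA -[X in mnat_iso _ X]smfunctor_compm1.
  exact: mnat_iso_whiskl.
have [f fP] := mnat_iso_lcc1 Pover; have [g gG] := mnat_iso_lcc1 Gover.
exists f, g; split; apply: lcc1_iso.
  by rewrite /= fP gG.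
by rewrite /= fP gG.
Qed.

(** * Connected and reduced cospans *)

Lemma class_connectedE (U : fin_universe) (A B : U) (x : cospan A B) :
  class_connected (class_of x) <-> #|El (apex x)| = 1.
Proof.
split=> [[y [[h [/bij_eq_card -> _ _]]]]//|x1].
by exists x; split=> //; apply: cospan_iso_refl.
Qed.

Lemma class_reducedE (U : fin_universe) (A B : U) (x : cospan A B) :
  class_reduced (class_of x) <->
  forall p, (exists a, lleg x a = p) \/ (exists b, rleg x b = p).
Proof.
split=> [[y [[h [[h' hK _] hl hr]] yr]] p|xr].
  by case: (yr (h p)) => [[a e]|[b e]]; [left; exists a|right; exists b];
    apply: (can_inj hK); rewrite -e ?hl ?hr.
by exists x; split=> //; apply: cospan_iso_refl.
Qed.

Section IsoSquare.
Variables (U : fin_universe) (A A' B B' : csp_smcat U).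
Variables (f : Hom A A') (g : Hom B B') (u : Hom A B) (u' : Hom A' B').
Hypotheses (fi : is_iso f) (gi : is_iso g) (sq : g ∘ u = u' ∘ f).

Lemma iso_square_apex : exists (x : cospan A B) (x' : cospan A' B')
    (h : El (apex x) -> El (apex x')) (f0 : El A -> El A') (g0 : El B -> El B'),
  [/\ u = class_of x, u' = class_of x', bijective h, bijective f0 & bijective g0] /\
  ((forall a, h (lleg x a) = lleg x' (f0 a)) /\
   (forall b, h (rleg x b) = rleg x' (g0 b))).
Proof.
have [f0 [fb fE]] := cospan_iso_graph fi; have [g0 [gb gE]] := cospan_iso_graph gi.
have [x xE] := class_ofP u; have [x' xE'] := class_ofP u'.
case: (gb) => g1 gK Kg; move: sq; rewrite fE gE xE xE' /=.
rewrite (class_cmpE (composite_graphr _ gK Kg)) (class_cmpE (composite_graphl _ _)).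
move=> /class_of_eq [h [hb hl hr]].
exists x, x', h, f0, g0; do ![split=> //] => b.
by rewrite -hr /= gK.
Qed.

Lemma iso_square_connected : class_connected u <-> class_connected u'.
Proof.
have [x [x' [h [f0 [g0 [[-> -> hb _ _] _]]]]]] := iso_square_apex.
by rewrite !class_connectedE (bij_eq_card hb).
Qed.

Lemma iso_square_reduced : class_reduced u <-> class_reduced u'.
Proof.
have [x [x' [h [f0 [g0 [[-> -> hb fb gb] [hl hr]]]]]]] := iso_square_apex.
case: hb fb gb => h' hK Kh [f1 fK Kf] [g1 gK Kg].
rewrite !class_reducedE; split=> xr p.
  case: (xr (h' p)) => [[a e]|[b e]].
    by left; exists (f0 a); rewrite -hl e Kh.
  by right; exists (g0 b); rewrite -hr e Kh.
case: (xr (h p)) => [[a e]|[b e]].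
  by left; exists (f1 a); apply: (can_inj hK); rewrite hl Kf.
by right; exists (g1 b); apply: (can_inj hK); rewrite hr Kg.
Qed.

End IsoSquare.

Lemma csp_iso_of_card (A B : finType) : #|A| = #|B| -> inhabited (@iso Csp A B).
Proof.
move=> e; constructor.
apply: (@graph_iso finset_universe A B
  (fun a => enum_val (cast_ord e (enum_rank a)))
  (fun b => enum_val (cast_ord (esym e) (enum_rank b)))) => x.
  by rewrite enum_valK cast_ordK enum_rankK.
by rewrite enum_valK cast_ordKV enum_rankK.
Qed.

(** * The strict labelled cospan category of words *)

Section WordLCC.
Variable Y : lcc.
Let C := lcc_car Y.
Let pi := lcc_pi Y.
Let T := {c : C | connected_ob pi c}.
Let D := word_smcat (@sval C (connected_ob pi)).
Let P : smfunctor D C := word_smfunctor (@sval C (connected_ob pi)).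

Lemma word_ff : fully_faithful P.
Proof. exact: word_functor_ff. Qed.

Lemma word_es (c : C) : exists s : D, inhabited (iso (P s) c).
Proof.
have [s [_ /Forall_sig [s' <-] [i]]] := lcc_ob (lcc_axioms Y) c.
by exists s'; constructor; apply: iso_inv.
Qed.

Lemma tens_map_singleton (s : D) : tens_map (fun x : T => [:: x] : D) s = s.
Proof. by elim: s => //= x s IH; rewrite /tens_map /= -/(tens_map _ s) IH. Qed.

(** The generators are the letters, each of which is sent to the ordinal 1. *)
Lemma word_pi_ex : exists F : smfunctor D Cstar,
  [/\ is_strict F, forall s : D, F s = size s
    & mnat_iso (smfunctor_comp (incl ordinal_universe) F) (smfunctor_comp pi P)].
Proof.
have k (x : T) : exists i : iso (incl ordinal_universe 1) (smfunctor_comp pi P [:: x]), True.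
  have [|i] := @csp_iso_of_card 'I_1 (pi (P [:: x])); last by exists i.
  have xi := is_iso_fmap pi (is_iso_iso (runit (sval x))).
  by rewrite card_ord (cospan_iso_card xi) (svalP x).
have [F [Fs FE Fpi]] := strict_lift_ex (@incl_ff ordinal_universe) Cstar_permutative
  (word_permutative _) tens_map_singleton erefl (fun _ _ => erefl)
  (fun x => sval (cid (k x))).
exists F; split=> // s; rewrite FE.
by elim: s => //= x s IH; rewrite /tens_map /= -/(tens_map _ s) IH.
Qed.

Section Projection.
Variables (F : smfunctor D Cstar) (Fs : is_strict F) (FE : forall s : D, F s = size s).
Variables (t : mnat (smfunctor_comp (incl ordinal_universe) F) (smfunctor_comp pi P)).
Hypothesis ti : forall s, is_iso (t s).

Lemma word_connected (c d : D) (f : Hom c d) :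
  connected_mor F f <-> connected_mor pi (fmap P f).
Proof.
rewrite /connected_mor -(@incl_connected ordinal_universe).
exact: iso_square_connected (ti c) (ti d) (tr_nat t f).
Qed.

Lemma word_reduced (c d : D) (f : Hom c d) :
  reduced_mor F f <-> reduced_mor pi (fmap P f).
Proof.
rewrite /reduced_mor -(@incl_reduced ordinal_universe).
exact: iso_square_reduced (ti c) (ti d) (tr_nat t f).
Qed.

Lemma word_connected_ob (c : D) : connected_ob F c <-> size c = 1.
Proof. by rewrite /connected_ob FE card_ord. Qed.

Let I : smfunctor Cstar Csp := incl ordinal_universe.
Let ti_iso (s : D) : iso (I (F s)) (pi (P s)) := sval (cid (is_iso_ex (ti s))).
Let ti_isoE (s : D) : fwd (ti_iso s) = t s := svalP (cid (is_iso_ex (ti s))).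

(** A cospan between the ordinals of two words, seen as a cospan between the
   sets that [pi] attaches to their tensor products. *)
Definition word_cospan (c d : D) (u : @Hom Cstar (F c) (F d)) : Hom (pi (P c)) (pi (P d)) :=
  ti_iso d ∘ (fmap I u ∘ bwd (ti_iso c)).

Lemma word_cospanE (c d : D) (u : @Hom Cstar (F c) (F d)) :
  t d ∘ fmap I u = word_cospan u ∘ t c.
Proof. by rewrite -!ti_isoE /word_cospan -!cmpA fwdK cmpm1. Qed.

Lemma word_cospan_eq (c d : D) (f : Hom c d) (u : @Hom Cstar (F c) (F d)) :
  fmap F f = u <-> fmap pi (fmap P f) = word_cospan u.
Proof.
have nat := tr_nat t f; split=> [<-|e].
  by apply: (iso_epi (f := ti_iso c)); rewrite ti_isoE -word_cospanE; exact: esym nat.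
apply: (fmap_inj (@incl_ff ordinal_universe)).
apply: (iso_mono (f := ti_iso d)); rewrite ti_isoE [LHS]nat word_cospanE.
exact: (congr1 (fun k => k ∘ t c) e).
Qed.

Lemma word_cospan_reduced (c d : D) (u : @Hom Cstar (F c) (F d)) :
  class_reduced u -> class_reduced (word_cospan u).
Proof.
move=> /(@incl_reduced ordinal_universe) ur.
exact/(iso_square_reduced (ti c) (ti d) (word_cospanE u)).
Qed.

Section Tensor.
Variables (c d c' d' : D) (h : Hom (c ⊗ c') (d ⊗ d')).

(** [h] seen in [C], between binary tensor products instead of tensor
   products of concatenated words. *)
Definition word_split : Hom (P c ⊗ P c') (P d ⊗ P d') :=
  bwd (smF2 P d d') ∘ (fmap P h ∘ smF2 P c c').

Lemma word_splitE : smF2 P d d' ∘ word_split = fmap P h ∘ smF2 P c c'.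
Proof. exact: bwdKA. Qed.

Lemma word_split_eq (f : Hom c d) (f' : Hom c' d') :
  f ⊠ f' = h <-> fmap P f ⊠ fmap P f' = word_split.
Proof.
split=> e.
  by apply: (iso_mono (f := smF2 P d d')); rewrite word_splitE -e smF2_nat.
apply: (fmap_inj word_ff); apply: (iso_epi (f := smF2 P c c')).
by rewrite -smF2_nat e word_splitE.
Qed.

Lemma word_split_reduced : reduced_mor F h -> reduced_mor pi word_split.
Proof.
move=> /word_reduced hr.
apply/(@iso_square_reduced finset_universe _ _ _ _ (fmap pi (smF2 P c c'))
  (fmap pi (smF2 P d d')) _ (fmap pi (fmap P h))) => //.
- exact/is_iso_fmap/is_iso_iso.
- exact/is_iso_fmap/is_iso_iso.
- by rewrite -[LHS]fmapM word_splitE fmapM.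
Qed.

Lemma word_split_cospan (u : @Hom Cstar (F c) (F d)) (u' : @Hom Cstar (F c') (F d')) :
  fmap F h ∘ smF2 F c c' = smF2 F d d' ∘ (u ⊠ u') ->
  fmap pi word_split ∘ smF2 pi (P c) (P c') =
  smF2 pi (P d) (P d') ∘ (word_cospan u ⊠ word_cospan u').
Proof.
move=> e; apply: (iso_mono (f := iso_fmap pi (smF2 P d d'))).
apply: (iso_epi (f := iso_tens (ti_iso c) (ti_iso c'))).
have tc : t (c ⊗ c') ∘ (fmap I (smF2 F c c') ∘ smF2 I (F c) (F c')) =
    fmap pi (smF2 P c c') ∘ (smF2 pi (P c) (P c') ∘ (t c ⊠ t c')).
  by rewrite [RHS]cmpA; exact: (mtr_tens t c c').
have td : t (d ⊗ d') ∘ (fmap I (smF2 F d d') ∘ smF2 I (F d) (F d')) =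
    fmap pi (smF2 P d d') ∘ (smF2 pi (P d) (P d') ∘ (t d ⊠ t d')).
  by rewrite [RHS]cmpA; exact: (mtr_tens t d d').
have th : t (d ⊗ d') ∘ fmap I (fmap F h) = fmap pi (fmap P h) ∘ t (c ⊗ c').
  exact: (tr_nat t h).
change (fmap pi (smF2 P d d') ∘ (fmap pi word_split ∘ smF2 pi (P c) (P c'))
    ∘ (ti_iso c ⊠ ti_iso c') =
  fmap pi (smF2 P d d') ∘ (smF2 pi (P d) (P d') ∘ (word_cospan u ⊠ word_cospan u'))
    ∘ (ti_iso c ⊠ ti_iso c')).
rewrite !ti_isoE -!cmpA -tensmM -!word_cospanE tensmM.
rewrite (cmpA (fwd (smF2 pi (P d) (P d')))) (cmpAE (esym td)) -!cmpA.
rewrite (smF2_nat I) (cmpA (fmap I (fwd (smF2 F d d')))) -fmapM -e fmapM.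
rewrite -!cmpA (cmpAE th) -!cmpA tc !cmpA; do !congr (_ ∘ _).
by rewrite -!fmapM word_splitE.
Qed.

End Tensor.

(** For [lcc_reduced] and [lcc_pullback], the solutions over words are literally
   the solutions of a problem in [C], since words have the same morphisms as
   their tensor products; [word_runit_square], [word_split_eq] and
   [word_cospan_eq] translate the problem. *)
Lemma word_is_lcc : @is_lcc ordinal_universe D F.
Proof.
split.
- move=> c; exists (map (fun x : T => [:: x] : D) c).
  have e : tens_seq (map (fun x : T => [:: x] : D) c) = c := tens_map_singleton c.
  rewrite size_map FE card_ord e; split=> //; last by constructor; apply: iso_id.
  by elim: (c) => [|x s IH] /=; constructor=> //; apply/word_connected_ob.
- have e : @connected_mor _ D F munit munit = @connected_mor _ C pi munit munit.
    by apply: functional_extensionality_dep => f; apply/propext/word_connected.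
  rewrite e; exact: lcc_free (lcc_axioms Y).
- move=> c d h.
  have eqv (fx : @Hom D c d * @Hom D munit munit) :
      (@reduced_mor _ D F c d fx.1 /\ h ∘ runit c = runit d ∘ (fx.1 ⊠ fx.2)) <->
      (@reduced_mor _ C pi (P c) (P d) (fmap P fx.1) /\
       fmap P h ∘ runit (P c) = runit (P d) ∘ (fmap P fx.1 ⊠ fmap P fx.2)).
    by split=> -[/word_reduced r /word_runit_square e].
  have [[f x] [fx un]] := lcc_reduced (lcc_axioms Y) (fmap P h).
  exists (f, x); split; first by apply/eqv.
  by move=> gy /eqv/un.
- move=> c d c' d' h u u' hr ur ur' e.
  have eqv (ff : @Hom D c d * @Hom D c' d') :
      [/\ @reduced_mor _ D F _ _ ff.1, @reduced_mor _ D F _ _ ff.2, ff.1 ⊠ ff.2 = h,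
          fmap F ff.1 = u & fmap F ff.2 = u'] <->
      [/\ @reduced_mor _ C pi _ _ (fmap P ff.1), @reduced_mor _ C pi _ _ (fmap P ff.2),
          fmap P ff.1 ⊠ fmap P ff.2 = word_split h,
          fmap pi (fmap P ff.1) = word_cospan u &
          fmap pi (fmap P ff.2) = word_cospan u'].
    by split=> -[/word_reduced r /word_reduced r' /word_split_eq k
      /word_cospan_eq v /word_cospan_eq v'].
  have [[f f'] [ff un]] := lcc_pullback (lcc_axioms Y) (word_split_reduced hr)
    (word_cospan_reduced ur) (word_cospan_reduced ur') (word_split_cospan e).
  exists (f, f'); split; first by apply/eqv.
  by move=> gg /eqv/un.
Qed.

Lemma word_uniq (c : D) : exists! s : seq D,
  [/\ size s = F c, List.Forall (connected_ob F) s & c = tens_seq s].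
Proof.
exists (map (fun x : T => [:: x] : D) c); split.
  split; first by rewrite size_map FE.
    by elim: (c) => [|x s IH] /=; constructor=> //; apply/word_connected_ob.
  exact: esym (tens_map_singleton c).
move=> s [_ sc ->]; elim: s sc => //= w s IH ws.
have [/word_connected_ob w1 /IH e] : connected_ob F w /\ List.Forall (connected_ob F) s.
  by inversion ws.
by case: w w1 {ws} => [|x [|y w]] //= _; rewrite e.
Qed.

Lemma word_slcc_equivalent : exists X : slcc, @equivalent_objects LCC (slcc_to_lcc_ob X) Y.
Proof.
pose X := SLCC_ob (word_permutative _) Fs word_is_lcc word_uniq.
exists X; refine (@lcc_equivalence (slcc_to_lcc_ob X) Y P word_ff word_es _).
by apply: mnat_iso_sym; exists t.
Qed.

End Projection.
End WordLCC.

Theorem theorem6p15 : is_biequivalence slcc_to_lcc.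
Proof.
split; last exact: slcc_hom_equivalence.
move=> Y; have [F [Fs FE [t ti]]] := word_pi_ex Y.
by have [X XY] := word_slcc_equivalent Fs FE ti; exists X.
Qed.
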